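(* Let $\mathbb{P}=\{\pm p : p \text{ a prime number}\}\subseteq\mathbb{R}$. With respect to the van Hove sequence $(A_n)_n=([-n,n])_n$, the counting autocorrelation of $\mathbb{P}$ exists and $\gamma_{\mathrm{count}}=\delta_0$, and the counting diffraction is $\widehat{\gamma_{\mathrm{count}}}=\lambda$, the Lebesgue measure on $\mathbb{R}$.
   Context: For a finite set $F\subseteq\mathbb{R}$ put $\gamma_F=\frac{1}{\mathrm{card}(F)}\sum_{x,y\in F}\delta_{x-y}$ if $F\neq\emptyset$ and $\gamma_\emptyset=0$. For a locally finite $\varLambda\subseteq\mathbb{R}$ and compact sets $A_n$, let $F_n=\varLambda\cap A_n$. The counting autocorrelation of $\varLambda$ with respect to $(A_n)_n$ is the vague limit $\gamma_{\mathrm{count}}=\lim_n\gamma_{F_n}$ (if it exists), i.e. $\gamma_{F_n}(f)\to\gamma_{\mathrm{count}}(f)$ for all compactly supported continuous $f$; its Fourier transform $\widehat{\gamma_{\mathrm{count}}}$ (a positive measure) is the counting diffraction. *)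

(* Defs.v *)
From mathcomp Require Import all_boot all_order all_algebra.
From mathcomp Require Import all_classical all_reals all_analysis.
From mathcomp Require Import complex.

Set Implicit Arguments.
Unset Strict Implicit.
Unset Printing Implicit Defensive.

Import Order.TTheory GRing.Theory Num.Theory.
Import numFieldNormedType.Exports.
Local Open Scope classical_set_scope.
Local Open Scope ring_scope.

Section Defs.
Variable R : realType.

Definition primes_pm : set R :=
  [set x | exists p : nat, prime p /\ (x = p%:R \/ x = - p%:R)].

Definition vanHove (n : nat) : set R := `[- (n%:R), n%:R].

Definition Fn (Lambda : set R) (n : nat) : set R := Lambda `&` vanHove n.

Definition cardR (F : set R) : R := \sum_(x \in F) (1 : R).

Definition gammaF (F : set R) (f : R -> R) : R :=
  if pselect (F = set0) then 0
  else (cardR F)^-1 * \sum_(x \in F) \sum_(y \in F) f (x - y).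

Definition Cc (f : R -> R) : Prop :=
  continuous f /\ compact (closure [set x | f x != 0]).

Definition vague_limit (gam : nat -> (R -> R) -> R)
  (mu : {measure set (measurableTypeR R) -> \bar R}) : Prop :=
  forall f : R -> R, Cc f -> gam n f @[n --> \oo] --> Rintegral mu setT f.

Definition counting_autocorrelation_is (Lambda : set R)
  (mu : {measure set (measurableTypeR R) -> \bar R}) : Prop :=
  vague_limit (fun n => gammaF (Fn Lambda n)) mu.

Local Open Scope complex_scope.

Definition cCc (f : R -> R[i]) : Prop :=
  Cc (fun x => complex.Re (f x)) /\ Cc (fun x => complex.Im (f x)).

Definition cintegrable (mu : {measure set (measurableTypeR R) -> \bar R}) (f : R -> R[i]) : Prop :=
  mu.-integrable setT (fun x => (complex.Re (f x))%:E) /\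
  mu.-integrable setT (fun x => (complex.Im (f x))%:E).

Definition cint (mu : {measure set (measurableTypeR R) -> \bar R}) (f : R -> R[i]) : R[i] :=
  (Rintegral mu setT (fun x => complex.Re (f x))) +i* (Rintegral mu setT (fun x => complex.Im (f x))).

Definition conv (f g : R -> R[i]) (x : R) : R[i] :=
  cint (@lebesgue_measure R) (fun y => f y * g (x - y)).

(** K_2(R): the C-linear span of { f * g : f, g in C_c(R, C) }
    (scalars are absorbed into the first factor). *)
Definition K2 (g : R -> R[i]) : Prop :=
  exists (m : nat) (f1 f2 : 'I_m -> R -> R[i]),
    (forall i, cCc (f1 i) /\ cCc (f2 i)) /\
    g = (fun x => \sum_(i < m) conv (f1 i) (f2 i) x).

Definition expi (t : R) : R[i] := (cos t) +i* (sin t).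

Definition check (g : R -> R[i]) (k : R) : R[i] :=
  cint (@lebesgue_measure R) (fun x => expi (2 * pi * k * x) * g x).

Definition is_fourier_transform (gam nu : {measure set (measurableTypeR R) -> \bar R}) : Prop :=
  forall g, K2 g -> cintegrable nu (check g) /\ cint nu (check g) = cint gam g.

End Defs.

(* Main.v *)
(** Every pair of distinct points of the set at distance at most K is, up to
    sign and finitely many exceptions, a prime pair (p, p + h) with h <= K.
    Hence the autocorrelation is the Dirac mass as soon as, for each fixed
    h > 0, such pairs have density zero among the primes.

    For a prime p > 4 not dividing h, let psi p be the function with value 1 off the
    classes 0 and -h modulo p, and constant on these two classes, with mean 0
    modulo p. The products phi T of the psi p, p in T, are nearly orthogonal on
    [0, N] and all equal 1 on the sifted set S. Expanding the second moment of
    their weighted average gives |S| <= N / G + (error), with G of order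
    (log N)^2, and Chebyshev's bound pi(N) >= c N / log N concludes.

    For the Fourier transform, let c be the convolution of u and w, continuous
    functions with compact support. Abel summation with the weight exp(-e|k|)
    turns the integral of the cosine transform of c into the integral of c
    against the Poisson kernel, which tends to c 0. For w(x) = u(-x) the
    transform is the squared modulus of that of u, so monotone convergence makes
    it integrable; Cauchy-Schwarz and dominated convergence give the general
    case. *)

From mathcomp Require Import all_boot all_order all_algebra.
From mathcomp Require Import zify ring lra.

Set Implicit Arguments.
Unset Strict Implicit.
Unset Printing Implicit Defensive.

Import Order.TTheory GRing.Theory Num.Theory.
Local Open Scope ring_scope.

(** * A large sieve inequality for two residue classes *)

(** By the Chinese remainder theorem [m |-> (m %% a, m %% b)] is a bijection from the residues
    modulo [a * b] to the pairs of residues. *)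
Lemma sum_coprime_periodic (R : comNzRingType) (a b : nat) (f g : nat -> R) :
  (0 < a)%N -> (0 < b)%N -> coprime a b ->
  (forall m, f (m %% a)%N = f m) -> (forall m, g (m %% b)%N = g m) ->
  \sum_(m < a * b) f m * g m = (\sum_(i < a) f i) * (\sum_(j < b) g j).
Proof.
move=> a0 b0 cab fP gP.
rewrite big_distrlr /= pair_big /=.
pose h (m : 'I_(a * b)) : 'I_a * 'I_b :=
  (Ordinal (ltn_pmod m a0), Ordinal (ltn_pmod m b0)).
have hI : injective h.
  move=> m n [] /eqP ma /eqP mb; apply/val_inj => /=.
  have /eqP : m == n %[mod a * b] by rewrite chinese_remainder // ma mb.
  by rewrite !modn_small.
have hB : bijective h.
  by apply: inj_card_bij => //; rewrite card_prod !card_ord.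
rewrite [RHS](reindex h) /=; last exact: onW_bij.
by apply: eq_bigr => m _; rewrite fP gP.
Qed.

(** Induction on [s]: the product over the tail is periodic modulo the product of its moduli, which
    is coprime to [q x]. *)
Lemma sum_prod_periodic (R : comNzRingType) (T : eqType) (s : seq T)
    (q : T -> nat) (F : T -> nat -> R) :
  uniq s -> {in s &, forall x y, x != y -> coprime (q x) (q y)} ->
  {in s, forall x, (0 < q x)%N /\ forall m, F x (m %% q x)%N = F x m} ->
  \sum_(m < \prod_(x <- s) q x) \prod_(x <- s) F x m =
  \prod_(x <- s) \sum_(m < q x) F x m.
Proof.
elim: s => [|x s IHs] /=; first by rewrite !big_nil big_ord1 big_nil.
move=> /andP[xs us] cop per; rewrite !big_cons.
have perS : {in s, forall x, (0 < q x)%N /\ forall m, F x (m %% q x)%N = F x m}.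
  by move=> y ys; apply: per; rewrite in_cons ys orbT.
rewrite -IHs //; last first.
  by move=> y z ys zs; apply: cop; rewrite in_cons ?ys ?zs orbT.
have [qx0 Fx] := per x (mem_head _ _).
rewrite -(sum_coprime_periodic (f := F x) (g := fun m => \prod_(y <- s) F y m)) //; last 2 first.
- rewrite big_seq; apply: (big_ind (fun n => coprime (q x) n)).
  + by rewrite coprimen1.
  + by move=> m n Hm Hn; rewrite coprimeMr Hm Hn.
  + move=> y ys; apply: cop; rewrite ?mem_head// ?in_cons ?ys ?orbT//.
    by apply: contraNneq xs => ->.
- move=> m; rewrite big_seq [RHS]big_seq; apply: eq_bigr => y ys.
  rewrite -(perS y ys).2 modn_dvdm ?(perS y ys).2//.
  by rewrite (perm_big _ (perm_to_rem ys)) big_cons dvdn_mulr.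
- by apply: eq_bigr => m _; rewrite big_cons.
- by rewrite big_seq prodn_cond_gt0 // => y ys; case: (perS y ys).
Qed.

(** The range splits into [N %/ P] full periods and fewer than [P] further terms, each at most [M].
    As the period sum is nonnegative, [N %/ P] may be replaced by the exact quotient. *)
Lemma sum_periodic_bound (R : realFieldType) (P N : nat) (f : nat -> R) (M : R) :
  (0 < P)%N -> (forall m, f (m %% P)%N = f m) ->
  (forall m, f m <= M) -> 0 <= M -> 0 <= \sum_(m < P) f m ->
  \sum_(m < N) f m <= N%:R / P%:R * \sum_(m < P) f m + P%:R * M.
Proof.
move=> P0 fP fM M0 S0.
set S := \sum_(m < P) f m in S0 *.
have sumq q : \sum_(m < q * P) f m = q%:R * S.
  elim: q => [|q IHq]; first by rewrite mul0n big_ord0 mul0r.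
  rewrite mulSn addnC big_split_ord /= IHq.
  under [X in _ + X]eq_bigr => i _ do rewrite -fP modnMDl modn_small //.
  by rewrite -/S -natr1 mulrDl mul1r.
have -> : \sum_(m < N) f m = \sum_(m < N %/ P * P + N %% P) f m by rewrite -divn_eq.
rewrite big_split_ord /= sumq; apply: lerD.
  apply: ler_wpM2r => //; rewrite ler_pdivlMr ?ltr0n// -natrM ler_nat.
  exact: leq_trunc_div.
apply: (@le_trans _ _ (\sum_(i < N %% P) M)); first by apply: ler_sum.
rewrite sumr_const card_ord -[X in X <= _]mulr_natl; apply: ler_wpM2r => //.
by rewrite ler_nat ltnW // ltn_pmod.
Qed.

Section Sieve.
Variables (R : realFieldType) (h Z : nat).

Definition bad (p m : nat) := (p %| m)%N || (p %| m + h)%N.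

(* The coefficient p / 2 makes the mean of [psi p] over a period vanish. *)
Definition psi (p m : nat) : R := 1 - p%:R / 2 * (bad p m)%:R.

Definition sieving_prime (p : nat) := [&& prime p, (4 < p)%N & ~~ (p %| h)%N].

(** The large sieve weight: two removed residue classes against the [p - 2] classes that remain. It
    is also the reciprocal of the mean of [psi p ^+ 2] over a period. *)
Definition gain (p : nat) : R := 2 / (p%:R - 2).

Lemma bad_mod p m : bad p (m %% p) = bad p m.
Proof. by rewrite /bad /dvdn modn_mod modnDml. Qed.

Lemma psi_mod p m : psi p (m %% p) = psi p m.
Proof. by rewrite /psi bad_mod. Qed.

Lemma sum_bad p : sieving_prime p -> (\sum_(m < p) bad p m = 2)%N.
Proof.
move=> /and3P[pp p4 ph].
have p0 : (0 < p)%N by exact: prime_gt0.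
(* The class of -h; it differs from the class 0 because [p] does not divide [h]. *)
pose r := (p - h %% p)%N.
have hp : (0 < h %% p)%N by rewrite lt0n.
have hp' : (h %% p < p)%N by rewrite ltn_pmod.
have rp : (r < p)%N by rewrite /r; lia.
have rh : (p %| r + h)%N.
  by rewrite /dvdn -modnDmr subnK ?modnn// ltnW.
have r0 : (r != 0)%N by rewrite /r; lia.
rewrite (bigD1 (Ordinal p0)) //= (bigD1 (Ordinal rp)) /=; last by rewrite -val_eqE /=.
rewrite big1 ?addn0; first by rewrite /bad dvdn0 rh orbT.
move=> i /andP[i0 ir]; apply/eqP; rewrite eqb0 /bad negb_or.
rewrite /dvdn modn_small // -val_eqE /= in i0 *; rewrite i0 /=.
apply: contra ir => ih; rewrite -val_eqE /=.
have : i + h = r + h %[mod p] by rewrite (eqP ih) (eqP rh).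
by move/eqP; rewrite eqn_modDr !modn_small.
Qed.

Lemma sum_psi p : sieving_prime p -> \sum_(m < p) psi p m = 0.
Proof.
move=> sp; rewrite big_split /= sumrN -mulr_sumr -natr_sum sum_bad //.
by rewrite sumr_const card_ord divfK ?pnatr_eq0// subrr.
Qed.

Lemma sieving_prime_gt4 p : sieving_prime p -> 4 < p%:R :> R.
Proof. by case/and3P => _ ? _; rewrite (ltr_nat _ 4 p). Qed.

Lemma sum_psi2 p : sieving_prime p -> \sum_(m < p) psi p m ^+ 2 = p%:R / gain p.
Proof.
move=> sp; have p4 := sieving_prime_gt4 sp.
(* Since [bad p m] is 0 or 1, the square is affine in it and only the number of bad classes
   matters. *)
have -> : \sum_(m < p) psi p m ^+ 2 =
    \sum_(m < p) (1 + (p%:R ^+ 2 / 4 - p%:R) * (bad p m)%:R).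
  by apply: eq_bigr => m _; rewrite /psi; case: (bad p m) => /=; field.
rewrite big_split /= sumr_const card_ord -mulr_sumr -natr_sum sum_bad //.
by rewrite /gain; field; apply/eqP; lra.
Qed.

Lemma gain_gt0 p : sieving_prime p -> 0 < gain p.
Proof. by move=> /sieving_prime_gt4 ?; rewrite divr_gt0 //; lra. Qed.

(** On the two bad classes equality holds, as the modulus of [psi p m] is p / 2 - 1 there; elsewhere
    [psi p m] is 1, and [gain p] is at most 1 because [4 < p]. *)
Lemma psi_le p m : sieving_prime p -> gain p * `|psi p m| <= 1.
Proof.
move=> sp; have p4 := sieving_prime_gt4 sp.
rewrite /gain /psi mulrAC ler_pdivrMr ?mul1r; last by lra.
by case: (bad p m); rewrite ?mulr1 ?mulr0 ?subr0 ?normr1;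
   [rewrite ler0_norm|]; lra.
Qed.

Implicit Types T U : {set 'I_Z}.

(* A set [T] of primes stands for the squarefree integer [mod_of T]. *)
Definition phi T m := \prod_(p in T) psi p m.
Definition gainT T := \prod_(p in T) gain p.
Definition mod_of T := (\prod_(p in T) (p : nat))%N.
Definition sievingT T := [forall p in T, sieving_prime p].

Lemma sievingTP T : reflect {in T, forall p, sieving_prime (p : 'I_Z)} (sievingT T).
Proof. exact: forall_inP. Qed.

Lemma gainT_gt0 T : sievingT T -> 0 < gainT T.
Proof. by move/sievingTP=> sT; apply: prodr_gt0 => p /sT/gain_gt0. Qed.

Lemma mod_of_gt0 T : sievingT T -> (0 < mod_of T)%N.
Proof.
by move/sievingTP=> sT; apply: prodn_cond_gt0 => p /sT/and3P[/prime_gt0].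
Qed.

Lemma mod_ofU_le T U : sievingT U -> (mod_of (T :|: U) <= mod_of T * mod_of U)%N.
Proof.
move=> sU; rewrite /mod_of (big_setID T) /= setUK setDUl setDv set0U.
rewrite leq_mul2l [X in (_ <= X)%N](big_setID T) /= leq_pmull ?orbT //.
by apply: prodn_cond_gt0 => p /setIP[/(sievingTP _ sU)/and3P[/prime_gt0]].
Qed.

Lemma phi_le T m : sievingT T -> gainT T * `|phi T m| <= 1.
Proof.
move/sievingTP=> sT; rewrite /gainT /phi normr_prod -big_split /=.
apply: (@le_trans _ _ (\prod_(p in T) (1 : R))); last by rewrite big1.
apply: ler_prod => p pT; rewrite psi_le ?sT // mulr_ge0 // ltW // gain_gt0 //.
exact: sT.
Qed.

(** The sum over a period factors over the primes of the union. If [T] and [U] differ, a prime in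
    exactly one of them contributes the factor 0 of [sum_psi]; if they agree, each prime contributes
    the factor of [sum_psi2]. *)
Lemma phi_mul_sum T U : sievingT T -> sievingT U ->
  \sum_(m < mod_of (T :|: U)) phi T m * phi U m =
  (T == U)%:R * (mod_of (T :|: U))%:R / gainT T.
Proof.
move=> sT sU.
have sTU : {in T :|: U, forall p, sieving_prime (p : 'I_Z)}.
  by move=> p /setUP[]; [apply/sievingTP: p|apply/sievingTP: p].
pose F (p : 'I_Z) m := (if p \in T then psi p m else 1) *
                       (if p \in U then psi p m else 1).
have FE m : phi T m * phi U m = \prod_(p <- enum (T :|: U)) F p m.
  rewrite big_enum /= big_split /= /phi; congr (_ * _).
    rewrite big_mkcond [RHS]big_mkcond; apply: eq_bigr => p _.
    by rewrite inE; case: (p \in T) => //=; case: ifP.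
  rewrite big_mkcond [RHS]big_mkcond; apply: eq_bigr => p _.
  by rewrite inE orbC; case: (p \in U) => //=; case: ifP.
have -> : mod_of (T :|: U) = (\prod_(p <- enum (T :|: U)) (p : nat))%N.
  by rewrite big_enum.
transitivity (\sum_(m < \prod_(p <- enum (T :|: U)) (p : nat))
  \prod_(p <- enum (T :|: U)) F p m); first by apply: eq_bigr => m _; exact: FE.
rewrite sum_prod_periodic ?enum_uniq //; first last.
- move=> p; rewrite mem_enum => /sTU sp; split.
    by case/and3P: sp => /prime_gt0.
  by move=> m; rewrite /F psi_mod.
- move=> p q; rewrite !mem_enum => /sTU/and3P[pp _ _] /sTU/and3P[pq _ _] npq.
  by rewrite prime_coprime // dvdn_prime2.
rewrite !big_enum /=.
have [eTU|neq] := eqVneq T U.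
  rewrite mul1r natr_prod -eTU setUid /gainT -prodf_div.
  apply: eq_bigr => p pT; rewrite -sum_psi2; last exact: (sievingTP _ sT).
  by apply: eq_bigr => m _; rewrite /F -eTU pT -expr2.
have [p pTU pdiff] : exists2 p, p \in T :|: U & (p \in T) != (p \in U).
  have [p np] : exists p, (p \in T) != (p \in U).
    apply/existsP; move: neq; apply: contraNT; rewrite negb_exists => /forallP e.
    by apply/eqP/setP => p; apply/eqP; move: (e p); rewrite negbK.
  by exists p => //; rewrite inE; case: (p \in T) np; case: (p \in U).
rewrite !mul0r (bigD1 p) //= [X in X * _](_ : _ = 0) ?mul0r //.
rewrite -[RHS](sum_psi (sTU _ pTU)); apply: eq_bigr => m _; rewrite /F.
by case: (p \in T) pdiff; case: (p \in U); rewrite ?mulr1 ?mul1r.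
Qed.

(* All [phi T] equal 1 on [S]; near-orthogonality evaluates the second moment of
   their average with weights [gainT T]. *)
Lemma sieve_inequality N (S : {set 'I_N}) (TT : {set {set 'I_Z}}) :
  (forall T, T \in TT -> sievingT T) ->
  (forall T (p : 'I_Z) (m : 'I_N), T \in TT -> p \in T -> m \in S -> ~~ bad p m) ->
  #|S|%:R * (\sum_(T in TT) gainT T) ^+ 2 <=
  N%:R * (\sum_(T in TT) gainT T) + ((\sum_(T in TT) mod_of T)%:R) ^+ 2.
Proof.
move=> sTT Sgood; set G := \sum_(T in TT) gainT T.
pose W m := \sum_(T in TT) gainT T * phi T m.
have WS (m : 'I_N) : m \in S -> W m = G.
  move=> mS; apply: eq_bigr => T TTT; rewrite /phi big1 ?mulr1 // => p pT.
  by rewrite /psi (negbTE (Sgood T p m _ _ _)) // mulr0 subr0.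
(* For the lower bound only the terms with [m] in [S] are kept, where [W] takes the value [G]. *)
apply: (@le_trans _ _ (\sum_(m < N) W m ^+ 2)).
  rewrite (bigID (mem S)) /= [X in _ <= X + _](eq_bigr (fun=> G ^+ 2)); last first.
    by move=> m /WS ->.
  by rewrite sumr_const mulr_natl lerDl sumr_ge0 // => m _; rewrite sqr_ge0.
have -> : \sum_(m < N) W m ^+ 2 =
    \sum_(T in TT) \sum_(U in TT) gainT T * gainT U * \sum_(m < N) phi T m * phi U m.
  under eq_bigr do rewrite expr2 big_distrlr /=.
  rewrite exchange_big /=; apply: eq_bigr => T _.
  rewrite exchange_big /=; apply: eq_bigr => U _.
  by rewrite mulr_sumr; apply: eq_bigr => m _; rewrite mulrACA.
have -> : N%:R * G = \sum_(T in TT) \sum_(U in TT) (T == U)%:R * (N%:R * gainT T).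
  rewrite mulr_sumr; apply: eq_bigr => T TTT.
  rewrite (bigD1 T) //= eqxx mul1r big1 ?addr0 // => U /andP[_ /negbTE nU].
  by rewrite eq_sym nU mul0r.
rewrite natr_sum expr2 big_distrlr /= -big_split /=; apply: ler_sum => T TTT.
rewrite -big_split /=; apply: ler_sum => U TUU.
have [sT sU] := (sTT _ TTT, sTT _ TUU).
have [gT gU] := (gainT_gt0 sT, gainT_gt0 sU).
have sTU : sievingT (T :|: U).
  by apply/sievingTP => p /setUP[]; [apply/sievingTP: p|apply/sievingTP: p].
have P0 := mod_of_gt0 sTU.
have P0' : 0 < (mod_of (T :|: U))%:R :> R by rewrite ltr0n.
(* By [phi_le], [M] bounds the product of [phi T] and [phi U]. The weights [gainT] cancel it, so the
   pair [T], [U] contributes an error of at most [mod_of T * mod_of U]. *)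
pose M := (gainT T)^-1 * (gainT U)^-1.
have := @sum_periodic_bound R (mod_of (T :|: U)) N (fun m => phi T m * phi U m) M P0.
rewrite phi_mul_sum //.
have dvdTU (V : {set 'I_Z}) p : V \subset T :|: U -> p \in V -> (p %| mod_of (T :|: U))%N.
  by move=> /subsetP VTU /VTU pV; rewrite /mod_of (bigD1 p) //= dvdn_mulr.
have phi_per (V : {set 'I_Z}) m : V \subset T :|: U -> phi V (m %% mod_of (T :|: U)) = phi V m.
  move=> VTU; apply: eq_bigr => p pV.
  by rewrite -psi_mod modn_dvdm ?psi_mod // (dvdTU V).
move=> H.
have {}H : \sum_(m < N) phi T m * phi U m <=
    N%:R / (mod_of (T :|: U))%:R * ((T == U)%:R * (mod_of (T :|: U))%:R / gainT T) +
    (mod_of (T :|: U))%:R * M.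
  apply: H => [m|m||].
  - by rewrite !phi_per ?subsetUl ?subsetUr.
  - apply: le_trans (ler_norm _) _; rewrite normrM /M ler_pM //.
      by rewrite -[leRHS]mul1r ler_pdivlMr // mulrC phi_le.
    by rewrite -[leRHS]mul1r ler_pdivlMr // mulrC phi_le.
  - by rewrite /M mulr_ge0 // invr_ge0 ltW.
  - by rewrite !mulr_ge0 ?invr_ge0 // ltW.
apply: le_trans (ler_wpM2l _ H) _; first by rewrite mulr_ge0 ?ltW.
rewrite mulrDr; apply: lerD.
  have [eTU|_] := eqVneq T U; last by rewrite !mul0r !mulr0.
  rewrite -eTU in P0' *; rewrite le_eqVlt; apply/orP; left; apply/eqP; field.
  by rewrite !gt_eqF.
have -> : gainT T * gainT U * ((mod_of (T :|: U))%:R * M) = (mod_of (T :|: U))%:R.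
  by rewrite /M; field; rewrite !gt_eqF.
by rewrite -natrM ler_nat mod_ofU_le.
Qed.
End Sieve.

(** * Lower bound for the sieve density *)

Lemma ler_sum_inj (R : numDomainType) (I J : finType) (P : pred I) (Q : pred J)
    (f : I -> J) (F : I -> R) (G : J -> R) :
  {in P &, injective f} -> (forall i, P i -> Q (f i)) ->
  (forall i, P i -> F i <= G (f i)) -> (forall j, Q j -> 0 <= G j) ->
  \sum_(i | P i) F i <= \sum_(j | Q j) G j.
Proof.
move=> finj PQ FG G0.
apply: (@le_trans _ _ (\sum_(i in [set i | P i]) G (f i))).
  rewrite [leRHS](eq_bigl P) => [|i]; last by rewrite inE.
  exact: ler_sum.
rewrite -(big_imset G) /=; last by move=> i j; rewrite !inE; apply: finj.
rewrite [leRHS](bigID (mem (f @: [set i | P i]))) /=.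
rewrite -[leLHS]addr0 lerD ?sumr_ge0 //; last by move=> j /andP[/G0].
rewrite le_eqVlt; apply/orP; left; apply/eqP; apply: eq_bigl => j.
apply/idP/andP => [|[]//] jf; split=> //.
by case/imsetP: jf => i; rewrite inE => /PQ ? ->.
Qed.

Section Sums.
Variable R : realFieldType.

Lemma sum_inv_sq n : \sum_(i < n) (i.+1%:R ^+ 2)^-1 <= 2 :> R.
Proof.
(* The sharper bound 2 - 1 / n is inductive, since 1 / (n + 1)^2 is at most 1 / n - 1 / (n + 1). *)
suff : (0 < n)%N -> \sum_(i < n) (i.+1%:R ^+ 2)^-1 <= 2 - n%:R^-1 :> R.
  case: n => [|n] H; first by rewrite big_ord0.
  by apply: le_trans (H isT) _; rewrite gerBl invr_ge0.
elim: n => [//|[|n] IHn _]; first by rewrite big_ord1 expr1n invr1; lra.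
rewrite big_ord_recr /=; apply: le_trans (lerD (IHn isT) (lexx _)) _.
have x0 : 0 < n.+1%:R :> R by rewrite ltr0n.
rewrite -(natr1 n.+1); set x := n.+1%:R in x0 *.
rewrite -subr_ge0.
have -> : 2 - (x + 1)^-1 - (2 - x^-1 + ((x + 1) ^+ 2)^-1) = (x * (x + 1) ^+ 2)^-1 :> R.
  by field; apply/andP; split; apply/eqP; lra.
by rewrite invr_ge0 mulr_ge0 ?exprn_ge0 //; lra.
Qed.

Lemma harmonic_pow2 j : j%:R / 2 <= \sum_(i < 2 ^ j) i.+1%:R^-1 :> R.
Proof.
elim: j => [|j IHj]; first by rewrite mul0r big_ord1 invr1.
rewrite expnS mul2n -addnn big_split_ord /= -natr1 mulrDl; apply: lerD => //.
(* The second half of the range has 2^j terms, each at least 1 / 2^(j + 1). *)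
apply: (@le_trans _ _ (\sum_(i < 2 ^ j) (2 ^ j.+1)%:R^-1)).
  rewrite sumr_const card_ord expnS natrM invfM -[leRHS]mulr_natr -mulrA mulVf ?mulr1 ?mul1r //.
  by rewrite pnatr_eq0 expn_eq0.
apply: ler_sum => i _; rewrite lef_pV2 ?posrE ?ltr0n ?expn_gt0 //.
by rewrite ler_nat expnS; have := ltn_ord i; lia.
Qed.
End Sums.

(** * Sums over squarefree integers composed of sieving primes *)

Section SieveDensity.
Variables (R : realFieldType) (h Z : nat).
Implicit Types T U A B E : {set 'I_Z}.
Local Notation sv T := (sievingT h T).
Local Notation wt T := ((mod_of T)%:R^-1 : R).

Lemma dvd_mod_of T (p : 'I_Z) : sv T -> prime p ->
  (p %| mod_of T)%N = (p \in T).
Proof.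
move=> sT pp; rewrite /mod_of Euclid_dvd_prod // big_has_cond.
apply/hasP/idP => [[q _ /andP[qT]]|pT]; last by exists p; rewrite ?mem_index_enum //= pT dvdnn.
have /and3P[pq _ _] := sievingTP _ _ sT _ qT.
by rewrite dvdn_prime2 // => /eqP /val_inj ->.
Qed.

(** Unique factorization: [T] is recovered as the set of primes in ['I_Z] that divide [mod_of T]. *)
Lemma mod_of_inj : {in (fun T : {set 'I_Z} => sv T) &, injective (@mod_of Z)}.
Proof.
move=> T U sT sU e; apply/setP => p.
have [pp|npp] := boolP (prime p); first by rewrite -!dvd_mod_of // e.
by apply/idP/idP => [/(sievingTP _ _ sT)|/(sievingTP _ _ sU)] /and3P[/(negP npp)].
Qed.

(** Since [mod_of] is injective on these sets, the sum is part of a sum of inverse squares of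
    distinct integers. *)
Lemma sum_wt_sq D : \sum_(E : {set 'I_Z} | sv E && (mod_of E <= D)%N) wt E ^+ 2 <= 2.
Proof.
apply: le_trans (sum_inv_sq R D.+1).
(* The predecessor matches the indexing of [sum_inv_sq], whose term at [i] is the inverse square of
   [i.+1]. *)
apply: (ler_sum_inj (f := fun E : {set 'I_Z} => inord (mod_of E).-1 : 'I_D.+1)) => //.
- move=> T U /andP[sT mT] /andP[sU mU] /(congr1 val); rewrite /= !inordK; try lia.
  move=> e; apply: mod_of_inj => //.
  by have := mod_of_gt0 sT; have := mod_of_gt0 sU; lia.
- move=> T /andP[sT mT]; have m0 := mod_of_gt0 sT.
  by rewrite inordK ?prednK ?exprVn //; lia.
- by move=> j _; rewrite invr_ge0 exprn_ge0.
Qed.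

(** Injectivity of [mod_of] allows at most [D.+1] sets, each contributing at most [D]. *)
Lemma sum_mod_of D : (\sum_(T : {set 'I_Z} | sv T && (mod_of T <= D)) mod_of T <= D.+1 ^ 2)%N.
Proof.
apply: (@leq_trans (\sum_(T : {set 'I_Z} | sv T && (mod_of T <= D)%N) D)).
  by apply: leq_sum => T /andP[].
rewrite sum_nat_const mulnC expnS expn1 leq_mul //.
rewrite -[X in (_ <= X)%N]card_ord -(@card_in_image _ _ (fun T => inord (mod_of T) : 'I_D.+1)).
  exact: max_card.
move=> T U /andP[sT mT] /andP[sU mU] /(congr1 val); rewrite /= !inordK ?ltnS //.
exact: mod_of_inj.
Qed.

(** Factor by factor, 2 / p is at most [gain p]. *)
Lemma pow2_wt_le_gainT T : sv T -> (2 ^ #|T|)%:R * wt T <= gainT R T.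
Proof.
move/sievingTP => sT; rewrite natrX -prodr_const /mod_of natr_prod -prodf_div.
apply: ler_prod => p /sT sp; rewrite divr_ge0 //= /gain.
have p4 := sieving_prime_gt4 R sp.
rewrite ler_pM2l // lef_pV2 ?posrE; lra.
Qed.

Lemma sievingT_sub T U : T \subset U -> sv U -> sv T.
Proof. by move=> /subsetP TU /sievingTP sU; apply/sievingTP => p /TU/sU. Qed.

(** [Gsum] is the denominator in the sieve bound and has to grow like the square of log D. [Wsum]
    sums the reciprocals of the squarefree moduli up to [Y]; it grows at least like log Y, and its
    square bounds [Gsum] from below. *)
Definition Gsum D := \sum_(T : {set 'I_Z} | sv T && (mod_of T <= D)%N) gainT R T.
Definition Wsum Y := \sum_(A : {set 'I_Z} | sv A && (mod_of A <= Y)%N) wt A.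

Definition symdiff A B := (A :\: B) :|: (B :\: A).

Lemma mod_ofID A B : mod_of A = (mod_of (A :&: B) * mod_of (A :\: B))%N.
Proof. exact: big_setID. Qed.

Lemma mod_of_symdiff A B : mod_of (symdiff A B) = (mod_of (A :\: B) * mod_of (B :\: A))%N.
Proof.
rewrite /mod_of (big_setID (A :\: B)) /= setUK setDUl setDv set0U.
congr (_ * _)%N; apply: eq_bigl => p; rewrite !inE.
by case: (p \in A); case: (p \in B).
Qed.

Lemma mod_ofM A B :
  (mod_of A * mod_of B = mod_of (A :&: B) ^ 2 * mod_of (symdiff A B))%N.
Proof.
rewrite mod_of_symdiff (mod_ofID A B) (mod_ofID B A) (setIC B A); lia.
Qed.

(* The map [(A, B) |-> (A :&: B, symdiff A B, A :\: B)] is injective, and a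
   given symmetric difference [T] leaves at most [2 ^ #|T|] choices for
   [A :\: B]. *)
Lemma Wsum_sq Y : Wsum Y ^+ 2 <= 2 * Gsum (Y ^ 2).
Proof.
rewrite /Wsum expr2 big_distrlr /= pair_big /=.
pose Q (x : {set 'I_Z} * ({set 'I_Z} * {set 'I_Z})) :=
  (sv x.1 && (mod_of x.1 <= Y)%N) &&
  ((sv x.2.1 && (mod_of x.2.1 <= Y ^ 2)%N) && (x.2.2 \subset x.2.1)).
apply: (@le_trans _ _ (\sum_(x | Q x) wt x.1 ^+ 2 * wt x.2.1)).
  apply: (ler_sum_inj
    (f := fun x : {set 'I_Z} * {set 'I_Z} =>
            (x.1 :&: x.2, (symdiff x.1 x.2, x.1 :\: x.2)))).
  - move=> [A B] [A' B'] _ _ [/setP eI /setP eS /setP eD].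
    by congr (_, _); apply/setP => p; move: (eI p) (eS p) (eD p); rewrite !inE;
      case: (p \in A); case: (p \in B); case: (p \in A'); case: (p \in B').
  - move=> [A B] /= /andP[/andP[sA mA] /andP[sB mB]].
    have sAB : sv (symdiff A B).
      apply/sievingTP => p; rewrite !inE => /orP[] /andP[_].
        by move/(sievingTP _ _ sA).
      by move/(sievingTP _ _ sB).
    have sI : sv (A :&: B) by apply: sievingT_sub sA; rewrite subsetIl.
    have sI0 := mod_of_gt0 sI; have e := mod_ofM A B.
    have A0 := mod_of_gt0 sA; have B0 := mod_of_gt0 sB.
    apply/andP; split; [apply/andP; split=> //|apply/andP; split].
    + apply: leq_trans mA; rewrite (mod_ofID A B) leq_pmulr //.
      by apply: mod_of_gt0; apply: sievingT_sub sA; rewrite subsetDl.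
    + rewrite sAB /=; nia.
    + by rewrite /symdiff subsetUl.
  - move=> [A B] _ /=; rewrite -invfM -natrM mod_ofM natrM natrX invfM.
    by rewrite exprVn.
  - by move=> x _; rewrite mulr_ge0 ?exprn_ge0 ?invr_ge0.
(* The sum over triples factors. The intersections contribute at most 2 by [sum_wt_sq]; the subsets
   of [T] contribute the factor [2 ^ #|T|], which [pow2_wt_le_gainT] absorbs. *)
rewrite -(pair_big (fun E : {set 'I_Z} => sv E && (mod_of E <= Y)%N)
   (fun x : {set 'I_Z} * {set 'I_Z} =>
      (sv x.1 && (mod_of x.1 <= Y ^ 2)%N) && (x.2 \subset x.1))
   (fun (E : {set 'I_Z}) x => wt E ^+ 2 * wt x.1)) /= -big_distrlr /=.
apply: ler_pM; rewrite ?sum_wt_sq ?sumr_ge0 //.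
- by move=> *; rewrite exprn_ge0 ?invr_ge0.
- by move=> *; rewrite invr_ge0.
rewrite -(pair_big_dep (fun T : {set 'I_Z} => sv T && (mod_of T <= Y ^ 2)%N)
   (fun T U : {set 'I_Z} => U \subset T) (fun T U : {set 'I_Z} => wt T)) /=.
apply: ler_sum => T /andP[sT _]; rewrite sumr_const -[leLHS]mulr_natl.
apply: le_trans (pow2_wt_le_gainT sT); rewrite -card_powerset.
apply: ler_wpM2r; first by rewrite invr_ge0.
by rewrite ler_nat subset_leq_card //; apply/subsetP => U; rewrite inE.
Qed.

(** Each exponent splits into its parity and twice its half, so the primes of odd exponent form the
    squarefree part. The bound [x < Z] puts every prime factor of [x] in ['I_Z]. *)
Lemma odd_part_decomp x : (0 < x < Z)%N ->
  x = (mod_of [set p : 'I_Z | odd (logn p x)] * (\prod_(p < Z) p ^ (logn p x)./2) ^ 2)%N.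
Proof.
move=> /andP[x0 xZ].
have -> : mod_of [set p : 'I_Z | odd (logn p x)] = (\prod_(p < Z) p ^ odd (logn p x))%N.
  by rewrite /mod_of big_mkcond; apply: eq_bigr => p _; rewrite inE; case: ifP.
rewrite expnS expn1 -!big_split /=.
case: Z xZ => // Z' xZ; rewrite ltnS in xZ.
rewrite -{1}(partnT x0) (widen_partn _ xZ) big_mkord; apply: eq_bigr => p _.
by rewrite -!expnD addnn odd_double_half.
Qed.

(** The integers 6hk + 1 with 1 <= k <= 2^j are coprime to 6h, so all their prime factors are
    sieving primes; being at most 7hk, they have reciprocal sum at least j / (14h). Writing each as
    a squarefree integer times a square bounds that sum by [Wsum] times a sum of inverse squares,
    which is at most 2. *)
Lemma Wsum_ge j : (0 < h)%N -> (7 * h * 2 ^ j < Z)%N -> j%:R / (28 * h%:R) <= Wsum (7 * h * 2 ^ j).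
Proof.
set Y := (7 * h * 2 ^ j)%N => h0 YZ.
have h0' : 0 < h%:R :> R by rewrite ltr0n.
pose x (k : 'I_(2 ^ j)) := (6 * h * k.+1 + 1)%N.
have x0 k : (0 < x k)%N by rewrite /x addn1.
have xY k : (x k <= Y)%N by rewrite /x /Y; have := ltn_ord k; nia.
have xZ k : (x k < Z)%N := leq_ltn_trans (xY k) YZ.
pose a k := [set p : 'I_Z | odd (logn p (x k))].
pose s k := (\prod_(p < Z) p ^ (logn p (x k))./2)%N.
have xE k : x k = (mod_of (a k) * s k ^ 2)%N by apply: odd_part_decomp; rewrite x0 xZ.
have s0 k : (0 < s k)%N by have := x0 k; rewrite xE; case: (s k) => //; rewrite muln0.
have sa k : sv (a k).
  apply/sievingTP => p; rewrite inE => odp.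
  have px : (p : nat) \in primes (x k) by rewrite -logn_gt0; case: (logn p (x k)) odp.
  have pp : prime p by move: px; rewrite mem_primes => /and3P[].
  have dpx : (p %| x k)%N by move: px; rewrite mem_primes => /and3P[].
  have ndp : ~~ (p %| 6 * h * k.+1)%N.
    by apply: contraL dpx => d6; rewrite /x dvdn_addr // dvdn1 neq_ltn prime_gt1 ?orbT.
  rewrite /sieving_prime pp /=; apply/andP; split.
    (* Below 5 only the primes 2 and 3 have to be excluded, and both divide 6. *)
    case: p pp ndp {odp px dpx} => -[|[|[|[|[|m]]]]] i //= _ /negP[].
      by rewrite -mulnA -[6%N]/(2 * 3)%N -mulnA dvdn_mulr.
    by rewrite -mulnA -[6%N]/(3 * 2)%N -mulnA dvdn_mulr.
  by apply: contra ndp => ph; rewrite dvdn_mulr // dvdn_mull.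
have ma0 k := mod_of_gt0 (sa k).
(* The pair [(a k, s k)] determines [x k], hence [k], so the sum embeds in the product of the two
   sums. *)
have key : \sum_(k < 2 ^ j) (x k)%:R^-1 <= Wsum Y * 2.
  apply: le_trans (_ : _ <= Wsum Y * \sum_(i < Y.+1) (i.+1%:R ^+ 2)^-1) _; last first.
    by rewrite ler_wpM2l ?sum_inv_sq // sumr_ge0 // => *; rewrite invr_ge0.
  rewrite /Wsum big_distrlr /= pair_big /=.
  apply: (ler_sum_inj (f := fun k => (a k, inord (s k).-1 : 'I_Y.+1))).
  - move=> k l _ _ [ea /(congr1 val)]; rewrite /= !inordK; last 2 first.
    + by have := xY l; rewrite xE; have := ma0 l; have := s0 l; nia.
    + by have := xY k; rewrite xE; have := ma0 k; have := s0 k; nia.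
    move=> es; have {}es : s k = s l by have := s0 k; have := s0 l; lia.
    have : x k = x l by rewrite !xE ea es.
    by rewrite /x => xx; apply/val_inj => /=; nia.
  - move=> k _ /=; rewrite sa andbT /=.
    by have := xY k; rewrite xE; have := ma0 k; have := s0 k; nia.
  - move=> k _ /=; rewrite inordK.
      by rewrite prednK // -invfM -natrX -natrM -xE.
    by have := xY k; rewrite xE; have := ma0 k; have := s0 k; nia.
  - by move=> i _; rewrite mulr_ge0 ?invr_ge0 ?exprn_ge0.
have : (7 * h%:R)^-1 * (j%:R / 2) <= \sum_(k < 2 ^ j) (x k)%:R^-1 :> R.
  apply: (@le_trans _ _ ((7 * h%:R)^-1 * \sum_(k < 2 ^ j) k.+1%:R^-1)).
    by apply: ler_wpM2l (harmonic_pow2 R j); rewrite invr_ge0 mulr_ge0.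
  rewrite mulr_sumr; apply: ler_sum => k _.
  rewrite -invfM lef_pV2 ?posrE ?ltr0n ?x0 //; last by rewrite !mulr_gt0 // ltr0n.
  by rewrite -!natrM ler_nat /x; nia.
move=> /le_trans /(_ key).
have -> : j%:R / (28 * h%:R) = (7 * h%:R)^-1 * (j%:R / 2) / 2 :> R.
  by field; rewrite gt_eqF.
by rewrite ler_pdivrMr.
Qed.

End SieveDensity.

(** * Prime pairs are negligible among primes *)

Definition prime_count N := (\sum_(p < N.+1) prime p)%N.
Definition prime_pair_count h N := (\sum_(p < N.+1) (prime p && prime (p + h)))%N.

Lemma sum_ltn M Z : (\sum_(m < M) (m < Z) = minn M Z)%N.
Proof.
elim: M => [|M IHM]; first by rewrite big_ord0 min0n.
by rewrite big_ord_recr /= IHM; case: (ltnP M Z) => /= ?; lia.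
Qed.

(** For fixed [h], sieving by primes up to D, of order 4^j, gives a main term N / G with G at least
    of order j^2, and an error of order D^4, that is, 2^(8j). The parameter [j] stays free, to be
    taken proportional to log N. *)
Lemma prime_pair_count_le (R : realFieldType) h : (0 < h)%N ->
  exists2 C : R, 0 < C & forall j N, (0 < j)%N ->
    (prime_pair_count h N)%:R <= C * (N.+1%:R / j%:R ^+ 2 + (2 ^ (8 * j))%:R).
Proof.
move=> h0; have h0' : 0 < h%:R :> R by rewrite ltr0n.
(* [Wsum_ge] and [Wsum_sq] give (j / (28h))^2 <= 2 G, that is, j^2 / c <= G. *)
pose c : R := 2 * (28 * h%:R) ^+ 2.
(* [Z] is 49 h^2 4^j + 1, hence at most [a] times 4^j. *)
pose a : R := 51 * h%:R ^+ 2.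
have c0 : 0 < c by rewrite /c mulr_gt0 ?exprn_gt0 ?mulr_gt0 //.
have a0 : 0 < a by rewrite /a mulr_gt0 ?exprn_gt0 ?mulr_gt0 //.
exists (c + (a + a ^+ 4 * c ^+ 2)).
  by rewrite !addr_gt0 // mulr_gt0 // exprn_gt0.
move=> j N j0.
pose Y := (7 * h * 2 ^ j)%N; pose D := (Y ^ 2)%N; pose Z := D.+1.
pose S := [set m : 'I_N.+1 | [&& (D < m)%N, prime m & prime (m + h)%N]].
pose TT := [set T : {set 'I_Z} | sievingT h T && (mod_of T <= D)%N].
have pow0 : (0 < 2 ^ j)%N by rewrite expn_gt0.
have YZ : (Y < Z)%N by rewrite /Z /D ltnS; nia.
(* Pairs with [p <= D] are counted trivially, by [Z]; only the larger ones are sieved. *)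
have cnt : (prime_pair_count h N <= Z + #|S|)%N.
  have -> : #|S| = (\sum_(m < N.+1) (m \in S))%N.
    by rewrite -sum1_card big_mkcond; apply: eq_bigr => m _; case: ifP.
  apply: (@leq_trans (\sum_(m < N.+1) ((m < Z) + (m \in S)))%N).
    apply: leq_sum => m _; rewrite inE ltnS ltnNge.
    by case: (leqP m D) => //= _; case: (prime m && _).
  by rewrite big_split /= leq_add2r sum_ltn geq_minr.
have sieve : #|S|%:R * Gsum R h Z D ^+ 2 <=
    N.+1%:R * Gsum R h Z D + (Z ^ 2)%:R ^+ 2.
  have -> : Gsum R h Z D = \sum_(T in TT) gainT R T by apply: eq_bigl => T; rewrite inE.
  apply: le_trans (@sieve_inequality R h Z N.+1 S TT _ _) _.
  - by move=> T; rewrite inE => /andP[].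
  (* For [m] in [S] both [m] and [m + h] are primes above [D], so no prime [p <= D] divides
     either. *)
  - move=> T p m; rewrite !inE => /andP[sT mT] pT /and3P[Dm pm pmh].
    have /and3P[pp _ _] := sievingTP _ _ sT _ pT.
    have pD : (p <= D)%N by rewrite -ltnS ltn_ord.
    rewrite /bad !dvdn_prime2 //; apply/norP; split; rewrite neq_ltn.
      by rewrite (leq_ltn_trans pD).
    by rewrite (leq_ltn_trans pD) // ltn_addr.
  rewrite lerD2l lerXn2r ?nnegrE // ler_nat.
  apply: leq_trans (sum_mod_of _ _ D); rewrite leq_eqVlt; apply/orP; left.
  by apply/eqP; apply: eq_bigl => T; rewrite inE.
set G := Gsum R h Z D in sieve.
have j0' : 0 < j%:R :> R by rewrite ltr0n.
have Glow : j%:R ^+ 2 / c <= G.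
  have W0 : 0 <= j%:R / (28 * h%:R) :> R by rewrite divr_ge0 // mulr_ge0.
  have W1 := Wsum_ge R h0 YZ.
  have := le_trans (lerXn2r 2 W0 (le_trans W0 W1) W1) (Wsum_sq R h Z Y).
  rewrite -/D -/G -ler_pdivrMl // => /(le_trans _); apply.
  by rewrite le_eqVlt; apply/orP; left; apply/eqP; rewrite /c; field; rewrite gt_eqF.
have G0 : 0 < G by apply: lt_le_trans Glow; rewrite divr_gt0 ?exprn_gt0.
have iG : G^-1 <= c / j%:R ^+ 2.
  by rewrite -[leRHS]invrK invf_div lef_pV2 ?posrE // divr_gt0 ?exprn_gt0.
have SG : #|S|%:R <= N.+1%:R / G + (Z ^ 2)%:R ^+ 2 * (G^-1) ^+ 2.
  rewrite -(ler_pM2r (exprn_gt0 2 G0)) (le_trans sieve) // le_eqVlt.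
  by apply/orP; left; apply/eqP; field; rewrite gt_eqF.
have Zle : Z%:R <= a * (2 ^ (2 * j))%:R.
  have -> : (2 ^ (2 * j) = (2 ^ j) ^ 2)%N by rewrite mulnC expnM.
  rewrite /a -natrX -!natrM ler_nat /Z /D /Y; set t := (2 ^ j)%N in pow0 *.
  by have : (0 < (h * t) ^ 2)%N; [rewrite expn_gt0 muln_gt0 h0 pow0|rewrite !expnMn; lia].
have pj1 : 1 <= (2 ^ (2 * j))%:R :> R by rewrite ler1n expn_gt0.
have iG1 : G^-1 <= c.
  apply: le_trans iG _; rewrite ler_pdivrMr ?exprn_gt0 // ler_peMr ?(ltW c0) //.
  by rewrite exprn_ege1 // ler1n.
set q : R := (2 ^ (2 * j))%:R in Zle pj1.
have qE : (2 ^ (8 * j))%:R = q ^+ 4 by rewrite /q -natrX -expnM mulnAC.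
apply: (@le_trans _ _ (Z%:R + (N.+1%:R / G + (Z ^ 2)%:R ^+ 2 * G^-1 ^+ 2))).
  by apply: le_trans (lerD (lexx _) SG); rewrite -natrD ler_nat.
rewrite qE.
have t1 : N.+1%:R / G <= c * (N.+1%:R / j%:R ^+ 2).
  by rewrite mulrCA; apply: ler_wpM2l.
have t2 : Z%:R <= a * q ^+ 4.
  apply: le_trans Zle _; rewrite ler_pM2l // -[leLHS]expr1.
  by apply: ler_weXn2l.
have q0 : 0 <= q := le_trans ler01 pj1.
have t3 : (Z ^ 2)%:R ^+ 2 * G^-1 ^+ 2 <= a ^+ 4 * c ^+ 2 * q ^+ 4.
  rewrite [leRHS]mulrAC -[in leRHS]exprMn natrX -exprM; apply: ler_pM => //.
  - by rewrite exprn_ge0.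
  - by rewrite exprn_ge0 ?invr_ge0 ?ltW.
  - by apply: lerXn2r => //; rewrite nnegrE //; apply: mulr_ge0 => //; rewrite ltW.
  - by apply: lerXn2r => //; rewrite nnegrE ltW // invr_gt0.
have q4 : 0 <= q ^+ 4 by rewrite exprn_ge0 // (le_trans ler01).
have n4 : 0 <= N.+1%:R / j%:R ^+ 2 :> R by rewrite divr_ge0 ?exprn_ge0.
have a4 : 0 <= a ^+ 4 * c ^+ 2 by rewrite mulr_ge0 ?exprn_ge0 ?ltW.
set u := a ^+ 4 * c ^+ 2 in t3 a4 *; set v := N.+1%:R / j%:R ^+ 2 in t1 n4 *.
set w := q ^+ 4 in t2 t3 q4 *.
have p1 : 0 <= c * w by rewrite mulr_ge0 // ltW.
have p2 : 0 <= a * v by rewrite mulr_ge0 // ltW.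
have p3 : 0 <= u * v by rewrite mulr_ge0.
rewrite !mulrDl !mulrDr; lra.
Qed.

(** * Chebyshev's lower bound and the comparison of prime pairs with primes *)

Lemma central_bin_ge n : (2 ^ n <= 'C(n.*2, n))%N.
Proof.
(* Pascal's rule splits the next central coefficient in two, each part at least ['C(n.*2, n)]. *)
elim: n => // n IHn; rewrite doubleS binS expnS mul2n -addnn leq_add //.
  by rewrite binS; apply: leq_trans IHn _; rewrite leq_addl.
apply: leq_trans IHn _.
by case: n => // n; rewrite [X in (_ <= X)%N]binS leq_addr.
Qed.

(** By Legendre's formula the exponent is the sum over k of floor(2n / p^k) - 2 floor(n / p^k). Each
    summand is at most 1 and vanishes once p^k exceeds 2n. *)
Lemma logn_central_bin p n : prime p -> (0 < n)%N ->
  (p ^ logn p 'C(n.*2, n) <= n.*2)%N.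
Proof.
move=> pp n0; set t := trunc_log p n.*2.
have p1 := prime_gt1 pp.
suff ht : (logn p 'C(n.*2, n) <= t)%N.
  apply: leq_trans (trunc_logP p1 _); last by rewrite double_gt0.
  by rewrite leq_exp2l.
have := bin_fact (leq_addr n n); rewrite addnn -addnn addnK addnn => e.
have : logn p (n.*2)`! = (logn p 'C(n.*2, n) + (logn p n`!).*2)%N.
  by rewrite -e !lognM ?muln_gt0 ?fact_gt0 ?bin_gt0 ?addnn // -addnn leq_addr.
rewrite !logn_fact // => e2.
(* The terms with k > n vanish, so the Legendre sum of n! may run over the same range as that of
   (2n)!. *)
have ext : (\sum_(1 <= k < n.*2.+1) n %/ p ^ k = \sum_(1 <= k < n.+1) n %/ p ^ k)%N.
  rewrite (@big_cat_nat _ _ _ n.+1 1 n.*2.+1) //=; last by rewrite ltnS -addnn leq_addr.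
  rewrite [X in (_ + X)%N]big_nat_cond [X in (_ + X)%N]big1 ?addn0 // => k.
  move=> /andP[/andP[nk _] _]; rewrite divn_small //.
  by apply: ltn_trans (ltn_expl _ p1); exact: nk.
rewrite -ext in e2.
have : (\sum_(1 <= k < n.*2.+1) n.*2 %/ p ^ k <=
        \sum_(1 <= k < n.*2.+1) ((n %/ p ^ k).*2 + (k <= t)))%N.
  rewrite big_nat_cond [X in (_ <= X)%N]big_nat_cond; apply: leq_sum => k.
  move=> /andP[/andP[k0 _] _]; have [kt|tk] := leqP k t.
    have q0 : (0 < p ^ k)%N by rewrite expn_gt0 prime_gt0.
    rewrite -ltnS ltn_divLR //.
    by have := divn_eq n (p ^ k); have := ltn_pmod n q0; nia.
  rewrite divn_small //; apply: leq_trans (trunc_log_ltn n.*2 p1) _.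
  by rewrite leq_exp2l.
rewrite big_split /= e2.
have -> : (\sum_(1 <= k < n.*2.+1) (n %/ p ^ k).*2 = (\sum_(1 <= k < n.*2.+1) (n %/ p ^ k)).*2)%N.
  by rewrite -!muln2 big_distrl /=; apply: eq_bigr => k _; rewrite muln2.
rewrite addnC leq_add2l => /leq_trans; apply.
have tn : (t <= n.*2)%N.
  by apply: leq_trans (trunc_logP p1 _); [exact: ltnW (ltn_expl _ _)|rewrite double_gt0].
rewrite (@big_cat_nat _ _ _ t.+1 1 n.*2.+1) //=.
rewrite [X in (_ + X <= _)%N]big_nat_cond [X in (_ + X <= _)%N]big1; last first.
  by move=> k /andP[/andP[tk _] _]; rewrite leqNgt tk.
rewrite addn0 (@leq_trans (\sum_(1 <= k < t.+1) 1)) //; first by apply: leq_sum => k _; case: (k <= t)%N.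
by rewrite sum_nat_const_nat muln1 subn1.
Qed.

(** With n = N / 2 rounded down, ['C(n.*2, n)] is a product of at most [prime_count N] prime powers,
    each at most 2n and hence below 2^(L + 1). With [central_bin_ge] this gives n <= (L + 1)
    [prime_count N], while N <= 3n. *)
Lemma chebyshev_lower L N : (0 < L)%N -> (2 ^ L <= N < 2 ^ L.+1)%N ->
  (N <= 6 * L * prime_count N)%N.
Proof.
move=> L0 /andP[LN NL].
have N2 : (2 <= N)%N.
  by apply: leq_trans LN; rewrite -[2%N]/(2 ^ 1)%N leq_exp2l.
pose n := N./2.
have n0 : (0 < n)%N by rewrite /n half_gt0.
have nN : (n.*2 <= N)%N by rewrite /n -{2}(odd_double_half N) leq_addl.
have Nn : (N <= 3 * n)%N by rewrite /n; have := odd_double_half N; lia.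
have binN : ('C(n.*2, n) <= 2 ^ (L.+1 * prime_count N))%N.
  have b0 : (0 < 'C(n.*2, n))%N by rewrite bin_gt0 -addnn leq_addr.
  rewrite -[X in (X <= _)%N](partnT b0) /partn.
  rewrite (eq_bigr (fun p => if prime p then p ^ logn p 'C(n.*2, n) else 1)%N); last first.
    by move=> p _; case: ifP => // np; rewrite lognE np.
  (* The range is enlarged so that it can be cut at [N] afterwards; a prime above the coefficient
     has exponent 0 in it. *)
  have -> : (\prod_(0 <= p < 'C(n.*2, n).+1 | p \in predT)
      (if prime p then p ^ logn p 'C(n.*2, n) else 1) =
     \prod_(0 <= p < 'C(n.*2, n).+1 + N.+1)
      (if prime p then p ^ logn p 'C(n.*2, n) else 1))%N.
    rewrite [RHS](@big_cat_nat _ _ _ ('C(n.*2, n).+1) 0 _) //= ?leq_addr //.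
    rewrite [X in (_ = _ * X)%N]big_nat_cond [X in (_ = _ * X)%N]big1 ?muln1 // => p.
    move=> /andP[/andP[bp _] _]; case: ifP => // pp.
    suff -> : logn p 'C(n.*2, n) = 0%N by [].
    apply/eqP; rewrite lognE pp b0 /=; case: ifP => // /dvdn_leq.
    by move=> /(_ b0); rewrite leqNgt bp.
  rewrite addnC (@big_cat_nat _ _ _ N.+1 0 _) //= ?leq_addr //.
  rewrite [X in (_ * X <= _)%N]big_nat_cond [X in (_ * X <= _)%N]big1 ?muln1; last first.
    move=> p /andP[/andP[Np _] _]; case: ifP => // pp.
    (* A prime dividing the coefficient is at most [n.*2], hence at most [N]. *)
    suff -> : logn p 'C(n.*2, n) = 0%N by [].
    have := logn_central_bin pp n0; case: (logn _ _) => // v.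
    rewrite expnS => /(leq_trans _) => /(_ p); rewrite leq_pmulr ?expn_gt0 ?prime_gt0 //.
    by move=> /(_ isT) /leq_trans /(_ nN); rewrite leqNgt Np.
  rewrite /prime_count big_mkord expnM expn_sum.
  apply: leq_prod => p _; case: ifP => // pp.
  rewrite expn1; apply: leq_trans (logn_central_bin pp n0) _.
  exact: leq_trans nN (ltnW NL).
have := leq_trans (central_bin_ge n) binN; rewrite leq_exp2l // => h.
by have : (L.+1 * prime_count N <= 2 * L * prime_count N)%N; [rewrite leq_mul2r; lia|lia].
Qed.

(** With j about log2 N / 16, both terms of [prime_pair_count_le] are at most of order N / j^2.
    Chebyshev's bound, N <= 192 j [prime_count N], then leaves a ratio of order 1 / j. *)
Lemma prime_pair_count_negligible (R : archiRealFieldType) h (e : R) :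
  (0 < h)%N -> 0 < e -> exists N0, forall N, (N0 <= N)%N ->
    (prime_pair_count h N)%:R <= e * (prime_count N)%:R.
Proof.
move=> h0 e0; have [C C0 HC] := prime_pair_count_le R h0.
(* Here 576 = 3 * 192: the factor 3 collects N + 1 <= 2N and the error term, and 192 = 6 * 32 comes
   from [chebyshev_lower] with [L <= 32 * j]. *)
pose J := (Num.bound (576 * C / e)).+1.
have JP : 576 * C / e < J%:R.
  apply: lt_le_trans (archi_boundP _) _; last by rewrite ler_nat leqnSn.
  by rewrite divr_ge0 ?mulr_ge0 ?ltW.
exists (2 ^ (16 * J))%N => N JN.
pose L := trunc_log 2 N.
have N0 : (0 < N)%N by apply: leq_trans JN; rewrite expn_gt0.
have /andP[L1 L2] := trunc_log_bounds (isT : 1 < 2)%N N0; rewrite -/L in L1 L2.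
have JL : (16 * J <= L)%N by rewrite -ltnS -(ltn_exp2l (m := 2)) // (leq_ltn_trans JN).
pose j := (L %/ 16)%N.
have jJ : (J <= j)%N by rewrite /j leq_divRL // mulnC.
have j0 : (0 < j)%N by apply: leq_trans jJ.
have Lj : (L <= 32 * j)%N by have := divn_eq L 16; have := ltn_pmod L (isT : 0 < 16)%N; rewrite -/j; lia.
have jL : (16 * j <= L)%N by rewrite mulnC leq_trunc_div.
have L0 : (0 < L)%N by lia.
have cheb := chebyshev_lower L0 (introT andP (conj L1 L2)).
have pw : (2 ^ (8 * j) * j ^ 2 <= N)%N.
  apply: leq_trans L1; apply: (@leq_trans (2 ^ (8 * j) * 2 ^ (8 * j))%N).
    rewrite leq_mul2l; apply/orP; right.
    apply: (@leq_trans (2 ^ (j * 2))%N); last by rewrite leq_exp2l //; lia.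
    by rewrite expnM leq_exp2r // ltnW // ltn_expl.
  by rewrite -expnD leq_exp2l //; lia.
have j0' : 0 < j%:R :> R by rewrite ltr0n.
apply: le_trans (HC j N j0) _.
have : (2 ^ (8 * j))%:R <= N%:R / j%:R ^+ 2 :> R.
  by rewrite ler_pdivlMr ?exprn_gt0 // -natrX -natrM ler_nat.
have : N.+1%:R / j%:R ^+ 2 <= 2 * (N%:R / j%:R ^+ 2) :> R.
  rewrite mulrA; apply: ler_wpM2r; first by rewrite invr_ge0 exprn_ge0.
  by rewrite -natrM ler_nat mul2n -addnn -addn1 leq_add2l.
move=> b1 b2.
have {b1 b2}b : C * (N.+1%:R / j%:R ^+ 2 + (2 ^ (8 * j))%:R) <= C * (3 * (N%:R / j%:R ^+ 2)).
  by rewrite ler_pM2l //; lra.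
apply: le_trans b _.
have chebR : N%:R <= 192 * j%:R * (prime_count N)%:R :> R.
  by rewrite -!natrM ler_nat; apply: leq_trans cheb _; rewrite leq_mul2r; lia.
apply: (@le_trans _ _ (C * (3 * (192 * j%:R * (prime_count N)%:R / j%:R ^+ 2)))).
  by rewrite !ler_pM2l // ler_pM2r // invr_gt0 exprn_gt0.
have -> : C * (3 * (192 * j%:R * (prime_count N)%:R / j%:R ^+ 2)) =
    576 * C / j%:R * (prime_count N)%:R :> R by field; rewrite gt_eqF.
apply: ler_wpM2r => //; rewrite ler_pdivrMr // -ler_pdivrMl // mulrC.
by apply: le_trans (ltW JP) _; rewrite ler_nat.
Qed.

(** * The autocorrelation of the primes *)

Lemma prime_count_unbounded A : exists N0, forall N, (N0 <= N)%N -> (A <= prime_count N)%N.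
Proof.
have mono M N : (M <= N)%N -> (prime_count M <= prime_count N)%N.
  move=> MN; rewrite /prime_count -(subnK (MN : (M.+1 <= N.+1)%N)) addnC.
  by rewrite big_split_ord /= leq_addr.
elim: A => [|A [N0 H]]; first by exists 0%N.
have [p Np pp] := prime_above N0.
exists p => N pN; apply: leq_trans (mono _ _ pN).
case: p Np pp {pN} => // p Np pp.
rewrite /prime_count big_ord_recr /= pp addn1 ltnS; exact: H.
Qed.

Lemma sum_prime_eq_le n m : (\sum_(q < n.+1 | prime q) ((q : nat) == m) <= prime m)%N.
Proof.
have [pm|npm] := boolP (prime m); last first.
  rewrite big1 // => q pq; apply/eqP; rewrite eqb0.
  by apply: contraNneq npm => <-.
apply: (@leq_trans (\sum_(q < n.+1) ((q : nat) == m))).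
  by rewrite big_mkcond /=; apply: leq_sum => q _; case: ifP.
have [mn|mn] := ltnP m n.+1.
  by rewrite (bigD1 (Ordinal mn)) //= eqxx big1 // => q qm; apply/eqP; rewrite eqb0.
by rewrite big1 // => q _; apply/eqP; rewrite eqb0 neq_ltn (leq_trans (ltn_ord q)).
Qed.

Section PrimeDifferences.
Variables (R : realFieldType) (f : R -> R) (M : R) (K n : nat).
Hypotheses (fM : forall x, `|f x| <= M) (fK : forall x, K%:R < `|x| -> f x = 0).

Let M0 : 0 <= M. Proof. exact: le_trans (normr_ge0 _) (fM 0). Qed.

(** The diagonal accounts for [f 0]. Off it a term vanishes unless the two primes differ by some h
    between 1 and [K]; each sign of the difference contributes at most [M] per prime pair. *)
Lemma sum_prime_differences :
  `|\sum_(p < n.+1 | prime p) \sum_(q < n.+1 | prime q) f (p%:R - q%:R) -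
    (prime_count n)%:R * f 0| <=
  2 * M * (\sum_(h < K) prime_pair_count h.+1 n)%:R.
Proof.
have -> : (prime_count n)%:R * f 0 =
    \sum_(p < n.+1 | prime p) \sum_(q < n.+1 | prime q) ((q : nat) == p)%:R * f 0.
  rewrite /prime_count natr_sum mulr_suml big_mkcond [RHS]big_mkcond /=.
  apply: eq_bigr => p _; case: ifP => pp; last by rewrite mul0r.
  rewrite (bigD1 p) //= eqxx big1 ?addr0 // => q /andP[_ qp].
  by rewrite (negbTE (qp : (q : nat) != p)) mul0r.
rewrite -sumrB; under eq_bigr do rewrite -sumrB.
(* [g p q] counts the shifts up to [K] that carry one of [p], [q] to the other, so it is positive at
   every off-diagonal pair where [f] need not vanish. *)
pose g (p q : nat) := (\sum_(h < K) ((q == p + h.+1) + (p == q + h.+1)))%N.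
have le1 (p q : nat) : `|f (p%:R - q%:R) - (q == p)%:R * f 0| <= M * (g p q)%:R.
  have [->|qp] := eqVneq q p.
    by rewrite subrr mul1r subrr normr0 mulr_ge0.
  rewrite mul0r subr0.
  have [hi|lo] := ltP K%:R `|p%:R - q%:R : R|.
    by rewrite fK // normr0 mulr_ge0.
  apply: le_trans (fM _) _; rewrite -[leLHS]mulr1 ler_wpM2l // ler1n.
  have [pq|] := ltnP p q.
    rewrite distrC ger0_norm ?subr_ge0 ?ler_nat ?(ltnW pq) // in lo.
    rewrite -natrB ?(ltnW pq) // ler_nat in lo.
    have hK : ((q - p).-1 < K)%N by lia.
    rewrite /g (bigD1 (Ordinal hK)) //=.
    have -> : (q == p + (q - p).-1.+1)%N by apply/eqP; lia.
    by [].
  move=> qp'; have {qp'}qp : (q < p)%N by lia.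
  rewrite ger0_norm ?subr_ge0 ?ler_nat ?(ltnW qp) // in lo.
  rewrite -natrB ?(ltnW qp) // ler_nat in lo.
  have hK : ((p - q).-1 < K)%N by lia.
  rewrite /g (bigD1 (Ordinal hK)) //=.
  have -> : (p == q + (p - q).-1.+1)%N by apply/eqP; lia.
  by rewrite addn1.
have le2 : (\sum_(p < n.+1 | prime p) \sum_(q < n.+1 | prime q) g p q <=
            2 * \sum_(h < K) prime_pair_count h.+1 n)%N.
  have pc h : (\sum_(p < n.+1 | prime p) \sum_(q < n.+1 | prime q) ((q : nat) == p + h)
               <= prime_pair_count h n)%N.
    rewrite /prime_pair_count [X in (X <= _)%N]big_mkcond /=; apply: leq_sum => p _.
    by case: ifP => //= _; exact: sum_prime_eq_le.
  rewrite /g; under eq_bigr do rewrite exchange_big /=.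
  rewrite exchange_big /= big_distrr /=; apply: leq_sum => h _.
  under eq_bigr do rewrite big_split /=.
  rewrite big_split /= mul2n -addnn leq_add //.
  by rewrite exchange_big /=.
apply: le_trans (ler_norm_sum _ _ _) _.
apply: (@le_trans _ _ (\sum_(p < n.+1 | prime p) \sum_(q < n.+1 | prime q) M * (g p q)%:R)).
  apply: ler_sum => p _; apply: le_trans (ler_norm_sum _ _ _) _.
  by apply: ler_sum => q _.
under eq_bigr do rewrite -mulr_sumr -natr_sum.
rewrite -mulr_sumr -natr_sum [leRHS]mulrAC mulrC; apply: ler_wpM2r => //.
by rewrite -natrM ler_nat.
Qed.

(** These terms come from elements of opposite sign: [p + q] stays within [K] only if both primes
    do, so the bound does not depend on [n]. *)
Lemma sum_prime_sums :
  `|\sum_(p < n.+1 | prime p) \sum_(q < n.+1 | prime q) f (p%:R + q%:R)| <=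
  M * (K.+1%:R) ^+ 2.
Proof.
have le1 (p q : nat) : `|f (p%:R + q%:R)| <= M * ((p < K.+1) * (q < K.+1))%:R.
  have [hi|lo] := ltP K%:R `|p%:R + q%:R : R|.
    by rewrite fK // normr0 mulr_ge0.
  rewrite -natrD normr_nat ler_nat in lo.
  have -> : (p < K.+1)%N by lia.
  have -> : (q < K.+1)%N by lia.
  by rewrite mulr1.
apply: le_trans (ler_norm_sum _ _ _) _.
apply: (@le_trans _ _ (\sum_(p < n.+1) \sum_(q < n.+1) M * ((p < K.+1) * (q < K.+1))%:R)).
  rewrite big_mkcond /=; apply: ler_sum => p _.
  case: ifP => _; last by apply: sumr_ge0 => q _; rewrite mulr_ge0.
  apply: le_trans (ler_norm_sum _ _ _) _; rewrite big_mkcond /=; apply: ler_sum => q _.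
  by case: ifP => _; rewrite ?le1 // mulr_ge0.
under eq_bigr do rewrite -mulr_sumr -natr_sum.
rewrite -mulr_sumr -natr_sum; apply: ler_wpM2l => //.
under eq_bigr do rewrite -big_distrr /= sum_ltn.
rewrite -big_distrl /= sum_ltn natrM expr2.
by apply: ler_pM => //; rewrite ler_nat geq_minr.
Qed.
End PrimeDifferences.

Require Import Defs.
From mathcomp Require Import all_boot all_order all_algebra.
From mathcomp Require Import all_classical all_reals all_analysis.
From mathcomp Require Import complex.
From mathcomp Require Import measurable_realfun lebesgue_integral_under.

Import Order.TTheory GRing.Theory Num.Theory.
Import numFieldNormedType.Exports.
Local Open Scope classical_set_scope.
Local Open Scope ring_scope.

(** * From sums over primes to the counting autocorrelation *)

Lemma Cc_bounded (R : realType) (f : R -> R) : Cc f ->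
  exists M K : R, [/\ 0 < M, 0 < K, forall x, `|f x| <= M & forall x, K < `|x| -> f x = 0].
Proof.
move=> [cf kf].
have /compact_bounded[M [_ HM]] : compact (f @` closure [set x | f x != 0]).
  by apply: continuous_compact => //; exact: continuous_subspaceT.
have [K [_ HK]] := compact_bounded kf.
(* Adding 1 passes strictly beyond the thresholds of the two boundedness statements and makes both
   constants positive. *)
exists (`|M| + 1), (`|K| + 1); split.
- by rewrite ltr_wpDl.
- by rewrite ltr_wpDl.
- move=> x; have [->|fx] := eqVneq (f x) 0; first by rewrite normr0 addr_ge0.
  apply: (HM (`|M| + 1)); first by rewrite (le_lt_trans (ler_norm _)) // ltrDl.
  by exists x => //; apply: subset_closure.
- move=> x Kx; apply: contrapT => /eqP fx; move: Kx; rewrite ltNge => /negP; apply.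
  apply: (HK (`|K| + 1)); first by rewrite (le_lt_trans (ler_norm _)) // ltrDl.
  exact: subset_closure.
Qed.

Lemma Rintegral_dirac0 (R : realType) (f : R -> R) : measurable_fun setT f ->
  Rintegral (@dirac _ (measurableTypeR R) 0 R) setT f = f 0.
Proof.
move=> mf; rewrite /Rintegral integral_dirac//; last exact/measurable_EFinP.
by rewrite diracE in_setT mul1e.
Qed.

Section PrimeSet.
Variables (R : realType) (n : nat).

Let P := [seq p <- index_iota 0 n.+1 | prime p].
Let s : seq R := [seq p%:R | p <- P] ++ [seq - p%:R | p <- P].

Let PE p : (p \in P) = (p <= n)%N && prime p.
Proof. by rewrite mem_filter mem_index_iota ltnS andbC. Qed.

Lemma Fn_primes_pmE : Fn (@primes_pm R) n = [set` s].
Proof.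
apply/seteqP; split=> x.
  move=> [[p [pp xp]]]; rewrite /vanHove /= in_itv /= => /andP[nx xn].
  have pP : p \in P.
    by rewrite PE pp andbT; case: xp nx xn => ->; rewrite ?lerN2 ler_nat.
  rewrite mem_cat; case: xp => ->; apply/orP; [left|right].
    by apply/mapP; exists p.
  by apply/mapP; exists p.
rewrite /= mem_cat => /orP[] /mapP[p]; rewrite PE => /andP[pn pp] ->; split.
- by exists p; split=> //; left.
- by rewrite /vanHove /= in_itv /= ler_nat pn andbT (@le_trans _ _ 0) ?oppr_le0.
- by exists p; split=> //; right.
- by rewrite /vanHove /= in_itv /= lerN2 ler_nat pn (@le_trans _ _ 0) ?oppr_le0.
Qed.

(** The set is listed without repetition, which turns the sum over a set into a sum over primes; the
    two halves of the list are disjoint because p = -q forces p = 0. *)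
Lemma sum_Fn_primes_pm (g : R -> R) :
  \sum_(x \in Fn (@primes_pm R) n) g x =
  \sum_(p < n.+1 | prime p) (g p%:R + g (- p%:R)).
Proof.
have us : uniq s.
  rewrite cat_uniq !map_inj_uniq ?filter_uniq ?iota_uniq //=; last 2 first.
  - by move=> p q /oppr_inj /eqP; rewrite eqr_nat => /eqP.
  - by move=> p q /eqP; rewrite eqr_nat => /eqP.
  rewrite andbT; apply/hasPn => x /mapP[p]; rewrite PE => /andP[_ pp] ->.
  apply/negP => /mapP[q _ /eqP]; rewrite eq_sym -subr_eq0 opprK -natrD.
  by rewrite pnatr_eq0 addn_eq0 => /andP[_ /eqP p0]; rewrite p0 in pp.
rewrite Fn_primes_pmE -fsbig_seq // big_cat !big_map !big_filter /= !big_mkord big_split.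
by [].
Qed.

End PrimeSet.

(** The four choices of signs give two sums over differences of primes and two over sums of primes,
    normalized by twice the prime count. Each difference sum is [f 0] times the prime count up to a
    negligible number of prime pairs; the other two stay bounded. *)
Theorem primes_pm_autocorrelation (R : realType) :
  counting_autocorrelation_is (@primes_pm R) (@dirac _ (measurableTypeR R) 0%R R).
Proof.
move=> f fC; have [M [K0 [M0 K00 fM fK0]]] := Cc_bounded fC.
rewrite Rintegral_dirac0; last by case: fC => cf _; exact: continuous_measurable_fun.
pose K := Num.bound K0.
have fK x : K%:R < `|x| -> f x = 0.
  move=> Kx; apply: fK0; apply: le_lt_trans Kx; apply/ltW.
  exact: archi_boundP (ltW K00).
apply/cvgrPdist_le => e e0.
(* Chosen so that the total error, 2 M (2K + 1) d times the prime count, equals [e] times the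
   cardinality of the set. *)
pose d := e / (M * (2 * K%:R + 1)).
have d0 : 0 < d by rewrite divr_gt0 // mulr_gt0 // ltr_wpDl.
have pc h : exists N0, forall N, (N0 <= N)%N ->
    (prime_pair_count h.+1 N)%:R <= d * (prime_count N)%:R.
  exact: prime_pair_count_negligible.
(* One threshold serves the finitely many shifts up to [K]; beyond [N2] the bounded sums are
   absorbed as well. *)
pose N1 := (\max_(h < K) projT1 (cid (pc h)))%N.
have [N2 HN2] := prime_count_unbounded (Num.bound (K.+1%:R ^+ 2 / d)).+1.
near=> n.
have N1n : (N1 <= n)%N by near: n; exact: nbhs_infty_ge.
have N2n : (N2 <= n)%N by near: n; exact: nbhs_infty_ge.
have pcn (h : 'I_K) : (prime_pair_count h.+1 n)%:R <= d * (prime_count n)%:R.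
  apply: (projT2 (cid (pc h))); apply: leq_trans N1n.
  exact: (leq_bigmax h).
set pn : R := (prime_count n)%:R in pcn.
have Kpn : K.+1%:R ^+ 2 <= d * pn.
  rewrite -ler_pdivrMl // mulrC; apply: ltW; apply: lt_le_trans (archi_boundP _) _.
    by rewrite divr_ge0 ?exprn_ge0 // ltW.
  by rewrite ler_nat ltnW // HN2.
have pn0 : 0 < pn by rewrite ltr0n; apply: leq_trans (HN2 _ N2n).
have cardE : cardR (Fn (@primes_pm R) n) = 2 * pn.
  rewrite /cardR sum_Fn_primes_pm /pn /prime_count natr_sum mulr_sumr big_mkcond.
  by apply: eq_bigr => p _; case: (prime p); rewrite ?mulr1 ?mulr0.
rewrite /gammaF; case: pselect => [F0|F0] /=.
  move: cardE; rewrite F0 /cardR fsbig_set0 => /esym/eqP.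
  by rewrite mulf_eq0 pnatr_eq0 /= gt_eqF.
rewrite cardE sum_Fn_primes_pm.
under eq_bigr do rewrite !sum_Fn_primes_pm.
(* When the first element is negative, the difference is the negative of one with positive first
   element, which the reflection absorbs. *)
pose g x := f (- x).
have gM x : `|g x| <= M by exact: fM.
have gK x : K%:R < `|x| -> g x = 0 by rewrite /g -normrN; exact: fK.
have D1 := sum_prime_differences n fM fK.
have D2 := sum_prime_differences n gM gK.
have S1 := sum_prime_sums n fM fK.
have S2 := sum_prime_sums n gM gK.
have -> : \sum_(i < n.+1 | prime i)
   (\sum_(p < n.+1 | prime p) (f (i%:R - p%:R) + f (i%:R - - p%:R)) +
    \sum_(p < n.+1 | prime p) (f (- i%:R - p%:R) + f (- i%:R - - p%:R))) =
  (\sum_(p < n.+1 | prime p) \sum_(q < n.+1 | prime q) f (p%:R - q%:R) +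
   \sum_(p < n.+1 | prime p) \sum_(q < n.+1 | prime q) f (p%:R + q%:R)) +
  (\sum_(p < n.+1 | prime p) \sum_(q < n.+1 | prime q) g (p%:R + q%:R) +
   \sum_(p < n.+1 | prime p) \sum_(q < n.+1 | prime q) g (p%:R - q%:R)).
  rewrite -!big_split /=; apply: eq_bigr => p _.
  rewrite -!big_split /=; apply: eq_bigr => q _.
  by rewrite /g !opprK opprB opprD addrC [X in _ = _ + (_ + f X)]addrC addrC.
set s1 := \sum_(p < _ | _) _ in D1 *; set s2 := \sum_(p < _ | _) _ in S1 *.
set s3 := \sum_(p < _ | _) _ in S2 *; set s4 := \sum_(p < _ | _) _ in D2 *.
set pcs : R := (\sum_(h < K) _)%:R in D1 D2.
have pcsK : pcs <= K%:R * (d * pn).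
  rewrite /pcs natr_sum; apply: le_trans (ler_sum _ (fun h _ => pcn h)) _.
  by rewrite sumr_const card_ord mulr_natl.
rewrite -/pn /g oppr0 in D1 D2.
rewrite -[leLHS](@mulfK _ (2 * pn)) ?gt_eqF ?mulr_gt0 // ler_pdivrMr ?mulr_gt0 //.
rewrite -{2}[2 * pn]ger0_norm ?mulr_ge0 ?(ltW pn0) // -normrM.
have -> : (f 0 - (2 * pn)^-1 * (s1 + s2 + (s3 + s4))) * (2 * pn) =
  - ((s1 - pn * f 0) + (s4 - pn * f 0) + s2 + s3).
  by field; rewrite gt_eqF.
rewrite normrN; apply: le_trans (ler_normD _ _) _; apply: le_trans (lerD (ler_normD _ _) S2) _.
apply: le_trans (lerD (lerD (ler_normD _ _) S1) (lexx _)) _.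
apply: le_trans (lerD (lerD (lerD D1 D2) (lexx _)) (lexx _)) _.
have -> : e * (2 * pn) = 2 * (M * (2 * (K%:R * (d * pn)) + d * pn)).
  by rewrite /d; field; rewrite !gt_eqF // ltr_wpDl // mulr_ge0.
have -> : 2 * M * pcs + 2 * M * pcs + M * K.+1%:R ^+ 2 + M * K.+1%:R ^+ 2 =
   2 * (M * (2 * pcs + K.+1%:R ^+ 2)) by ring.
by rewrite !ler_pM2l // lerD // ler_pM2l.
Unshelve. all: by end_near.
Qed.

(** * Integration over the real line *)

Section RealIntegral.
Variable R : realType.
Local Notation mu := (@lebesgue_measure R).
Local Notation L1 f := (mu.-integrable setT (EFin \o (f : R -> R))).
Local Notation I f := (Rintegral mu setT (f : R -> R)).
Implicit Types f g : R -> R.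

Lemma L1_measurable f : L1 f -> measurable_fun setT f.
Proof. by move/measurable_int/measurable_EFinP. Qed.

Lemma le_L1 f g : measurable_fun setT f -> L1 g -> (forall x, `|f x| <= g x) -> L1 f.
Proof.
move=> mf ig fg; apply: le_integrable ig => //; first exact/measurable_EFinP.
by move=> x _; rewrite /= lee_fin (le_trans (fg x)) // ler_norm.
Qed.

Lemma L1D f g : L1 f -> L1 g -> L1 (fun x => f x + g x).
Proof. by move=> fi gi; apply: (integrableD measurableT fi gi). Qed.

Lemma L1N f : L1 f -> L1 (fun x => - f x).
Proof.
move=> fi; apply: le_L1 (integrable_norm fi) _ => [|x]; last by rewrite normrN.
by apply: measurableT_comp => //; exact: L1_measurable.
Qed.

Lemma L1Zl k f : L1 f -> L1 (fun x => k * f x).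
Proof. by move=> fi; apply: (integrableZl measurableT k fi). Qed.

Lemma RintD f g : L1 f -> L1 g -> I (fun x => f x + g x) = I f + I g.
Proof. exact: RintegralD. Qed.

Lemma RintB f g : L1 f -> L1 g -> I (fun x => f x - g x) = I f - I g.
Proof. exact: RintegralB. Qed.

Lemma RintZl k f : L1 f -> I (fun x => k * f x) = k * I f.
Proof. exact: RintegralZl. Qed.

Lemma Rint_le f g : L1 f -> L1 g -> (forall x, f x <= g x) -> I f <= I g.
Proof. by move=> fi gi fg; apply: le_Rintegral. Qed.

Lemma Rint_norm_le f g : measurable_fun setT f -> L1 g ->
  (forall x, `|f x| <= g x) -> `|I f| <= I g.
Proof.
move=> mf gi fg; have fi := le_L1 mf gi fg.
apply: le_trans (le_normr_Rintegral measurableT fi) _.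
by apply: Rint_le => //; exact: integrable_norm.
Qed.

Lemma Rint_fin f : L1 f -> (\int[mu]_x (f x)%:E)%E = (I f)%:E.
Proof. by move=> fi; rewrite /Rintegral fineK //; apply: integrable_fin_num. Qed.

Section ChangeOfVariables.
Local Notation T := (measurableTypeR R).
Variable phi : T -> T.
Hypothesis mphi : measurable_fun [set: T] phi.
Hypothesis phiE : forall a b, mu (phi @^-1` `]a, b]) = mu `]a, b].

Let push : {measure set (measurableTypeR R) -> \bar R} :=
  measure_function_pushforward__canonical__measure_function_Measure mu mphi.

(** Lebesgue measure is determined by its values on half-open intervals, so [phiE] makes [phi]
    measure preserving. *)
Let pushE A : measurable A -> mu A = push A.
Proof.
apply: (@lebesgue_measure_unique R push) => X [[a b] _ <-] /=.
by rewrite /pushforward phiE.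
Qed.

Lemma L1_comp f : L1 f -> L1 (f \o phi).
Proof.
move=> fi; have mf := L1_measurable fi.
apply/integrableP; split; first by apply/measurable_EFinP; exact: measurableT_comp.
have mabs : measurable_fun [set: T] (fun x => `|f x|%:E).
  by apply/measurable_EFinP; exact: measurableT_comp.
have := ge0_integral_pushforward mphi mu measurableT mabs (fun y _ => normr_ge0 _).
rewrite preimage_setT => <-.
rewrite -[X in (X < _)%E]/(\int[push]_x `|f x|%:E)%E.
rewrite (@eq_measure_integral _ _ _ setT mu push); last by move=> A mA _; rewrite -pushE.
by case/integrableP: fi.
Qed.

Lemma Rint_comp f : L1 f -> I (f \o phi) = I f.
Proof.
move=> fi; rewrite /Rintegral; congr fine.
have mf : measurable_fun setT (EFin \o f) by exact: measurable_int fi.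
rewrite [RHS](@eq_measure_integral _ _ _ setT push mu) //; last by move=> A mA _; exact: pushE.
by rewrite integral_pushforward ?preimage_setT //; exact: L1_comp.
Qed.
End ChangeOfVariables.

Lemma Rint_shift a f : L1 f -> L1 (fun x => f (x + a)) /\ I (fun x => f (x + a)) = I f.
Proof.
move=> fi.
have mphi : measurable_fun setT (fun x : R => x + a).
  by apply: continuous_measurable_fun => x; apply: cvgD; [exact: cvg_id|exact: cvg_cst].
have phiE c b : mu ((fun x : R => x + a) @^-1` `]c, b]) = mu `]c, b].
  have -> : (fun x : R => x + a) @^-1` `]c, b] = `]c - a, b - a]%classic.
    by apply/seteqP; split => x /=; rewrite !in_itv /= lerBrDr ltrBlDr.
  by rewrite !lebesgue_measure_itv /= !lte_fin ltrD2r -!EFinB (_ : b - a - (c - a) = b - c) //; ring.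
by split; [exact: (L1_comp mphi phiE fi)|exact: (Rint_comp mphi phiE fi)].
Qed.

Lemma Rint_opp f : L1 f -> L1 (fun x => f (- x)) /\ I (fun x => f (- x)) = I f.
Proof.
move=> fi.
have mphi : measurable_fun setT (fun x : R => - x).
  by apply: continuous_measurable_fun => x; apply: cvgN; exact: cvg_id.
have phiE c b : mu ((fun x : R => - x) @^-1` `]c, b]) = mu `]c, b].
  (* Reflection moves the closed end to the other side, which does not change the length. *)
  have -> : (fun x : R => - x) @^-1` `]c, b] = `[- b, - c[%classic.
    by apply/seteqP; split => x /=; rewrite !in_itv /= andbC lerNl ltrNr.
  by rewrite !lebesgue_measure_itv /= !lte_fin ltrN2 -!EFinB opprK addrC.
by split; [exact: (L1_comp mphi phiE fi)|exact: (Rint_comp mphi phiE fi)].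
Qed.

Lemma continuous_Rint (F : R -> R -> R) g :
  (forall x, measurable_fun setT (F x)) -> (forall y, continuous (F ^~ y)) ->
  L1 g -> (forall x y, `|F x y| <= g y) -> continuous (fun x => I (F x)).
Proof.
move=> mF cF gi Fg x.
(* Continuity under the integral sign is applied on a bounded open interval; any one around [x]
   serves. *)
have xI : x \in `]x - 1, x + 1[%classic.
  by rewrite inE /= in_itv /= ltrBlDr ltrDl ltr01.
apply: (@continuity_under_integral R _ _ mu F setT measurableT (x - 1) (x + 1) _ _ g) xI => //.
- by move=> t _; exact: le_L1 (mF t) gi (Fg t).
- by apply/aeW => y _ t _; exact: cF.
- by move=> t _; apply/aeW.
Qed.

(** Domination by a product of integrable functions makes [F] integrable on the plane by Tonelli, so
    that Fubini applies. *)
Lemma Rint_fubini (F : R -> R -> R) (a b : R -> R) :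
  measurable_fun setT (fun z : measurableTypeR R * measurableTypeR R => F z.1 z.2) ->
  L1 a -> L1 b -> (forall x y, `|F x y| <= a x * b y) ->
  L1 (fun x => I (F x)) /\ I (fun x => I (F x)) = I (fun y => I (F ^~ y)).
Proof.
move=> mF ai bi Fab.
have mF1 x : measurable_fun setT (F x).
  by apply: (measurableT_comp mF (f := fun z => F z.1 z.2) (g := pair x)).
have mF2 y : measurable_fun setT (F ^~ y).
  by apply: (measurableT_comp mF (f := fun z => F z.1 z.2) (g := fun x => (x, y))).
have F1 x : L1 (F x) by apply: (le_L1 (mF1 x) (L1Zl (a x) bi)).
have F2 y : L1 (F ^~ y).
  by apply: (le_L1 (mF2 y) (L1Zl (b y) ai)) => x; rewrite mulrC.
have mFE : measurable_fun setT
    (fun z : measurableTypeR R * measurableTypeR R => (F z.1 z.2)%:E).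
  exact/measurable_EFinP.
have iF : (mu \x mu)%E.-integrable setT
    (fun z : measurableTypeR R * measurableTypeR R => (F z.1 z.2)%:E).
  apply/integrable12ltyP => //.
  apply: (@le_lt_trans _ _ (\int[mu]_x (`|a x| * I (fun y => `|b y|))%:E)%E).
    apply: ge0_le_integral => //.
    - by move=> x _; apply: integral_ge0 => y _; rewrite lee_fin.
    - apply: (@measurable_fun_fubini_tonelli_F _ _ _ _ _ mu
         (fun z : measurableTypeR R * measurableTypeR R => `|F z.1 z.2|%:E)) => //.
      by apply/measurable_EFinP; exact: measurableT_comp.
    - apply/measurable_EFinP; apply: measurable_funM => //.
      by apply: measurableT_comp => //; exact: L1_measurable.
    - move=> x _; have bi' := integrable_norm bi.
      rewrite -RintZl // -(Rint_fin (L1Zl _ bi')).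
      apply: ge0_le_integral => //.
      + by apply/measurable_EFinP; apply: measurableT_comp (mF1 x).
      + apply/measurable_EFinP; apply: measurable_funM => //.
        exact: L1_measurable.
      + move=> y _; rewrite lee_fin; apply: le_trans (Fab x y) _.
        by rewrite -normrM ler_norm.
  have ai' : L1 (fun x => `|a x| * I (fun y => `|b y|)).
    have -> : (fun x => `|a x| * I (fun y => `|b y|)) =
              (fun x => I (fun y => `|b y|) * `|a x|) by apply/funext => x; rewrite mulrC.
    exact: L1Zl (integrable_norm ai).
  by have /= -> := Rint_fin ai'; rewrite ltry.
have E1 : EFin \o (fun x => I (F x)) =
    fubini_F mu (fun z : measurableTypeR R * measurableTypeR R => (F z.1 z.2)%:E).
  by apply/funext => x; rewrite /fubini_F /= Rint_fin.
split.
- by rewrite E1; apply: integrable_fubini_F.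
- rewrite /Rintegral; congr fine.
  transitivity (\int[mu]_x (EFin \o (fun x => I (F x))) x)%E; first exact: erefl.
  by rewrite E1; rewrite (Fubini iF); apply: eq_integral => y _; rewrite /= Rint_fin.
Qed.

End RealIntegral.

(** * The Poisson kernel *)

Section Poisson.
Variable R : realType.
Local Notation mu := (@lebesgue_measure R).
Local Notation L1 f := (mu.-integrable setT (EFin \o (f : R -> R))).
Local Notation I f := (Rintegral mu setT (f : R -> R)).

(** The integral is twice the one over the positive half-line, where [F] is a primitive. A separate
    [g] lets [f] fail to be smooth at 0, as [ekern] does: the two have to agree only for positive
    arguments. *)
Lemma even_FTC (f g F : R -> R) (l : R) :
  (forall x, 0 <= f x) -> continuous f -> (forall x, f (- x) = f x) ->
  (forall x : R, is_derive x (1 : R) F (g x)) -> (forall x, 0 < x -> f x = g x) ->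
  F x @[x --> +oo] --> l -> L1 f /\ I f = 2 * (l - F 0).
Proof.
move=> f0 cf fe dF fg Fl.
have H : (\int[mu]_x (f x)%:E)%E = (2 * (l - F 0))%:E.
  rewrite ge0_symfun_integralT //; last by move=> x /=; rewrite fe.
  rewrite -set_itvcy (@ge0_continuous_FTC2y _ f F 0 l) //.
  - exact: continuous_subspaceT.
  - apply: cvg_at_right_filter; apply: differentiable_continuous.
    by apply/derivable1_diffP; exact: ex_derive.
  - move=> x; rewrite in_itv /= andbT => x0.
    by rewrite derive1E derive_val fg.
have fi : L1 f.
  apply/integrableP; split.
    by apply/measurable_EFinP; exact: continuous_measurable_fun.
  under eq_integral do rewrite /= ger0_norm //.
  by rewrite H ltry.
by split=> //; rewrite /Rintegral H.
Qed.

(** [ekern] is the Abel summation weight; [pkern] is its Fourier transform, the Poisson kernel, with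
    2 pi in the phase. *)
Definition ekern (e k : R) := expR (- (e * `|k|)).
Definition pkern (e x : R) := 2 * e / (e ^+ 2 + (2 * pi * x) ^+ 2).

Lemma ekern_ge0 e k : 0 <= ekern e k. Proof. exact: expR_ge0. Qed.

Lemma continuous_ekern e : continuous (ekern e).
Proof.
move=> k; apply: continuous_comp; last exact: continuous_expR.
by apply: cvgN; apply: cvgM; [exact: cvg_cst|exact: norm_continuous].
Qed.

Lemma pkern_ge0 e x : 0 < e -> 0 <= pkern e x.
Proof. by move=> e0; rewrite divr_ge0 ?mulr_ge0 ?addr_ge0 ?sqr_ge0 ?ltW. Qed.

Lemma cvg_expR_Nmul (e : R) : 0 < e -> expR (- (e * x)) @[x --> +oo] --> 0.
Proof.
move=> e0; apply: (cvg_comp (fun x => e * x) (fun x => expR (- x))); last exact: cvgr_expR.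
by apply: gt0_cvgMry => //; exact: cvg_id.
Qed.

Lemma is_derive_lin_comp (b k df : R) (f : R -> R) :
  is_derive (b * k) (1 : R) f df -> is_derive k (1 : R) (fun x => f (b * x)) (b * df).
Proof.
move=> dF.
have dl : is_derive k (1 : R) (fun x : R => b * x) b.
  have := is_deriveZ b (is_derive_id k (1 : R)).
  by rewrite -[b *: 1]/(b * 1) mulr1.
rewrite mulrC; exact: (@is_derive1_comp _ f (fun x => b * x) k df b dF dl).
Qed.

Section EkernCos.
Variables (e a : R).
Hypothesis e0 : 0 < e.

Let D := e ^+ 2 + a ^+ 2.
Let D0 : D != 0. Proof. by rewrite gt_eqF // ltr_pwDl ?sqr_ge0 ?exprn_gt0. Qed.

(** A primitive of exp(-e k) (1 + cos(a k)) that tends to 0 at infinity. *)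
Let F (k : R) := expR (- e * k) * (D^-1 * (a * sin (a * k) - e * cos (a * k)) - e^-1).

Let dF (k : R) : is_derive k (1 : R) F (expR (- e * k) * (1 + cos (a * k))).
Proof.
have dE := @is_derive_lin_comp (- e) k _ expR (is_derive_expR _).
have dS := @is_derive_lin_comp a k _ sin (is_derive_sin _).
have dC := @is_derive_lin_comp a k _ cos (is_derive_cos _).
have dG := is_deriveB (is_deriveZ a dS) (is_deriveZ e dC).
have dH := is_deriveB (is_deriveZ D^-1 dG) (is_derive_cst e^-1 k (1 : R)).
apply: (@is_derive_eq _ _ _ _ _ _ _ _ (is_deriveM dE dH)).
rewrite /= /GRing.scale /= -!/(_ * _) subr0.
set E := expR _; set s := sin _; set c := cos _.
have -> : E * (D^-1 * (a * (a * c) - e * (a * - s))) +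
   (D^-1 * (a * s - e * c) - e^-1) * (- e * E) =
   E * (c * (a ^+ 2 + e ^+ 2) * D^-1 + e * e^-1) by ring.
by rewrite divff ?gt_eqF // -mulrA [a ^+ 2 + _]addrC divff // mulr1 addrC.
Qed.

Let cvgF : F x @[x --> +oo] --> 0.
Proof.
pose C := `|D^-1| * (`|a| + `|e|) + `|e^-1|.
apply/cvgr0Pnorm_le => d d0.
have C0 : 0 < C + 1 by rewrite ltr_wpDl // addr_ge0 // mulr_ge0 ?addr_ge0.
have /cvgr0Pnorm_le/(_ (d / (C + 1))) := cvg_expR_Nmul e0.
move=> /(_ (divr_gt0 d0 C0)); apply: filterS => x.
rewrite ger0_norm ?expR_ge0 // ler_pdivlMr // => H.
apply: le_trans H; rewrite /F normrM ger0_norm ?expR_ge0 // mulNr.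
apply: ler_wpM2l; first exact: expR_ge0.
apply: (@le_trans _ _ C); last by rewrite lerDl.
apply: le_trans (ler_normB _ _) _; rewrite /C lerD2r normrM ler_wpM2l //.
apply: le_trans (ler_normB _ _) _; rewrite !normrM lerD //.
  by rewrite ler_piMr // ler_norml sin_geN1 sin_le1.
by rewrite ler_piMr // ler_norml cos_geN1 cos_le1.
Qed.

(* The summand 1 makes the integrand nonnegative, as [ge0_continuous_FTC2y]
   requires. *)
Lemma ekern_1Dcos : L1 (fun k => ekern e k * (1 + cos (a * k))) /\
  I (fun k => ekern e k * (1 + cos (a * k))) = 2 / e + 2 * e / D.
Proof.
have [||||||fi ->] := @even_FTC (fun k => ekern e k * (1 + cos (a * k)))
    (fun k => expR (- e * k) * (1 + cos (a * k))) F 0.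
- by move=> k; rewrite mulr_ge0 ?ekern_ge0 // -lerBlDl sub0r cos_geN1.
- move=> k; apply: cvgM; first exact: continuous_ekern.
  apply: cvgD; first exact: cvg_cst.
  apply: (cvg_comp (fun k => a * k) cos); last exact: continuous_cos.
  by apply: cvgM; [exact: cvg_cst|exact: cvg_id].
- by move=> k; rewrite /ekern normrN mulrN cosN.
- exact: dF.
- by move=> k k0; rewrite /ekern gtr0_norm // mulNr.
- exact: cvgF.
split=> //; rewrite /F !mulr0 expR0 sin0 cos0 mulr0 mulr1 sub0r mul1r sub0r.
by field; rewrite D0 gt_eqF.
Qed.
End EkernCos.

(** The case [a = 0] of [ekern_1Dcos], where the integrand is twice the weight. *)
Lemma ekern_L1 e : 0 < e -> L1 (ekern e) /\ I (ekern e) = 2 / e.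
Proof.
move=> e0; have [] := ekern_1Dcos 0 e0.
have -> : (fun k => ekern e k * (1 + cos (0 * k))) = (fun k => 2 * ekern e k).
  by apply/funext => k; rewrite mul0r cos0 mulrC.
move=> Li Ii.
have Le : L1 (ekern e).
  have := L1Zl 2^-1 Li; congr (mu.-integrable setT (EFin \o _)).
  by apply/funext => k; rewrite mulrA mulVf ?mul1r.
split => //; move: Ii; rewrite RintZl // expr0n addr0 => H.
apply: (mulfI (_ : 2 != 0 :> R)) => //; rewrite H.
by field; rewrite gt_eqF.
Qed.

Lemma Rint_ekern_cos e x : 0 < e -> I (fun k => ekern e k * cos (2 * pi * k * x)) = pkern e x.
Proof.
move=> e0; have [Li Ii] := ekern_1Dcos (2 * pi * x) e0.
have [Le Ie] := ekern_L1 e0.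
have -> : (fun k => ekern e k * cos (2 * pi * k * x)) =
    (fun k => ekern e k * (1 + cos (2 * pi * x * k)) - ekern e k).
  by apply/funext => k; rewrite (_ : 2 * pi * k * x = 2 * pi * x * k); ring.
by rewrite RintB // Ii Ie addrC addKr.
Qed.

(** The primitive atan(2 pi x / e) / pi is 0 at the origin and tends to 1 / 2. *)
Lemma pkern_L1 e : 0 < e -> L1 (pkern e) /\ I (pkern e) = 1.
Proof.
move=> e0.
pose b : R := 2 * pi / e.
have b0 : 0 < b by rewrite divr_gt0 // mulr_gt0 // pi_gt0.
have [||||||fi ->] := @even_FTC (pkern e) (pkern e) (fun x => pi^-1 * atan (b * x)) 2^-1.
- by move=> x; exact: pkern_ge0.
- move=> x; apply: cvgM; first exact: cvg_cst.
  apply: cvgV; first by rewrite gt_eqF // ltr_pwDl ?sqr_ge0 ?exprn_gt0.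
  apply: cvgD; first exact: cvg_cst.
  by rewrite expr2; apply: cvgM; apply: cvgM; [exact: cvg_cst|exact: cvg_id|exact: cvg_cst|exact: cvg_id].
- by move=> x; rewrite /pkern mulrN sqrrN.
- move=> x.
  have dA := @is_derive_lin_comp b x _ atan (is_derive1_atan _).
  apply: (@is_derive_eq _ _ _ _ _ _ _ _ (is_deriveZ pi^-1 dA)).
  rewrite /GRing.scale /= /pkern /b.
  have p0 := pi_gt0 R.
  have : e ^+ 2 + (2 * pi * x) ^+ 2 != 0 by rewrite gt_eqF // ltr_pwDl ?sqr_ge0 ?exprn_gt0.
  move: p0 e0; clear; move: (pi : R) => p p0 e0 q0; field.
  by rewrite q0 !gt_eqF.
- by [].
- have -> : 2^-1 = pi^-1 * (pi / 2) :> R by rewrite mulrA mulVf ?mul1r // gt_eqF // pi_gt0.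
  apply: cvgM; first exact: cvg_cst.
  apply: (cvg_comp (fun x => b * x) atan); last exact: cvgy_atan.
  by apply: gt0_cvgMry => //; exact: cvg_id.
- by split=> //; rewrite mulr0 atan0 mulr0 subr0 divff.
Qed.
End Poisson.

(** * Cosine and sine transforms *)

Section Transforms.
Variable R : realType.
Local Notation mu := (@lebesgue_measure R).
Local Notation L1 f := (mu.-integrable setT (EFin \o (f : R -> R))).
Local Notation I f := (Rintegral mu setT (f : R -> R)).
Implicit Types (u w c T : R -> R) (k x y e : R).

(** For real [c], [ct] and [st] are the real and imaginary parts of [check]; the analysis is done on
    them, with real integrals only. *)
Definition ct c k := I (fun x => cos (2 * pi * k * x) * c x).
Definition st c k := I (fun x => sin (2 * pi * k * x) * c x).
Definition rconv u w x := I (fun y => u y * w (x - y)).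

Lemma L1_bounded_mul T c : measurable_fun setT T -> (forall x, `|T x| <= 1) ->
  L1 c -> L1 (fun x => T x * c x).
Proof.
move=> mT T1 ci; apply: le_L1 (integrable_norm ci) _.
  by apply: measurable_funM => //; exact: L1_measurable.
by move=> x; rewrite normrM ler_piMl.
Qed.

Lemma continuous_comp_mull (f : R -> R) k : continuous f -> continuous (fun x => f (k * x)).
Proof.
move=> cf x; apply: (cvg_comp (fun x => k * x) f); last exact: cf.
by apply: cvgM; [exact: cvg_cst|exact: cvg_id].
Qed.

Lemma cosM_measurable k : measurable_fun setT (fun x : R => cos (k * x)).
Proof.
by apply: continuous_measurable_fun; apply: continuous_comp_mull; exact: continuous_cos.
Qed.

Lemma sinM_measurable k : measurable_fun setT (fun x : R => sin (k * x)).
Proof.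
by apply: continuous_measurable_fun; apply: continuous_comp_mull; exact: continuous_sin.
Qed.

Lemma norm_cos_le1 x : `|cos x| <= 1.
Proof. by rewrite ler_norml cos_geN1 cos_le1. Qed.

Lemma norm_sin_le1 x : `|sin x| <= 1.
Proof. by rewrite ler_norml sin_geN1 sin_le1. Qed.

Lemma cosL1 k c : L1 c -> L1 (fun x => cos (k * x) * c x).
Proof.
by apply: L1_bounded_mul; [exact: cosM_measurable|move=> x; exact: norm_cos_le1].
Qed.

Lemma sinL1 k c : L1 c -> L1 (fun x => sin (k * x) * c x).
Proof.
by apply: L1_bounded_mul; [exact: sinM_measurable|move=> x; exact: norm_sin_le1].
Qed.

Lemma continuous_transform T c : continuous T -> (forall x, `|T x| <= 1) -> L1 c ->
  continuous (fun k => I (fun x => T (2 * pi * k * x) * c x)).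
Proof.
move=> cT T1 ci; apply: (@continuous_Rint R _ (fun x => `|c x|)).
- move=> k; apply: measurable_funM; last exact: L1_measurable.
  by apply: continuous_measurable_fun; exact: continuous_comp_mull.
- move=> y k; apply: cvgM; last exact: cvg_cst.
  apply: (cvg_comp (fun k => 2 * pi * k * y) T); last exact: cT.
  by apply: cvgM; [apply: cvgM; [exact: cvg_cst|exact: cvg_id]|exact: cvg_cst].
- exact: integrable_norm.
- by move=> k x; rewrite normrM ler_piMl.
Qed.

Lemma ct_continuous c : L1 c -> continuous (ct c).
Proof. exact: continuous_transform (@continuous_cos R) norm_cos_le1. Qed.

Lemma st_continuous c : L1 c -> continuous (st c).
Proof. exact: continuous_transform (@continuous_sin R) norm_sin_le1. Qed.

Lemma st_oppE c k : L1 c -> st c (- k) = - st c k.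
Proof.
move=> ci; rewrite /st -[RHS]mulN1r -RintZl; last exact: sinL1.
apply: eq_Rintegral => x _.
by rewrite mulrN mulNr sinN mulN1r mulNr.
Qed.

(** The sine transform is odd, so its integral equals its own negative. *)
Lemma Rint_st c : L1 c -> L1 (st c) -> I (st c) = 0.
Proof.
move=> ci si; have [_] := Rint_opp si.
have -> : (fun x => st c (- x)) = (fun x => -1 * st c x).
  by apply/funext => x; rewrite st_oppE // mulN1r.
by rewrite RintZl // mulN1r; lra.
Qed.

Lemma ct_reflect c k : L1 c -> ct (fun x => c (- x)) k = ct c k.
Proof.
move=> ci; rewrite [RHS]/ct; have [_ <-] := Rint_opp (cosL1 (2 * pi * k) ci); apply: eq_Rintegral => x _.
by rewrite mulrN cosN.
Qed.

Lemma st_reflect c k : L1 c -> st (fun x => c (- x)) k = - st c k.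
Proof.
move=> ci; rewrite /st -[RHS]mulN1r -RintZl; last exact: sinL1.
have [_ <-] := Rint_opp (L1Zl (-1) (sinL1 (2 * pi * k) ci)); apply: eq_Rintegral => x _.
by rewrite mulrN sinN mulN1r mulNr opprK.
Qed.

(** Fubini: integrating the weight times the cosine over [k] first yields the Poisson kernel. *)
Lemma Rint_ekern_ct e c : 0 < e -> L1 c ->
  L1 (fun k => ekern e k * ct c k) /\
  I (fun k => ekern e k * ct c k) = I (fun x => c x * pkern e x).
Proof.
move=> e0 ci; have [ei _] := ekern_L1 e0.
pose F k x := ekern e k * (cos (2 * pi * k * x) * c x).
have mF : measurable_fun setT (fun z : measurableTypeR R * measurableTypeR R => F z.1 z.2).
  apply: measurable_funM.
    apply: (measurableT_comp (f := ekern e)) => //.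
    by apply: continuous_measurable_fun; exact: continuous_ekern.
  apply: measurable_funM.
    apply: (measurableT_comp (f := (@cos R))) => //.
      by apply: continuous_measurable_fun; exact: continuous_cos.
    by apply: measurable_funM => //; exact: measurable_funM.
  by apply: (measurableT_comp (f := c)) => //; exact: L1_measurable.
have bF k x : `|F k x| <= ekern e k * `|c x|.
  rewrite /F normrM ger0_norm ?ekern_ge0 // ler_wpM2l ?ekern_ge0 //.
  by rewrite normrM ler_piMl ?norm_cos_le1.
have [Fi] := Rint_fubini mF ei (integrable_norm ci) bF.
rewrite /F => H.
have FE : (fun k => I (F k)) = (fun k => ekern e k * ct c k).
  by apply/funext => k; rewrite /ct -RintZl //; exact: cosL1.
rewrite -FE; split; first exact: Fi.
rewrite H; apply: eq_Rintegral => x _.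
rewrite -(Rint_ekern_cos x e0) -RintZl.
  by apply: eq_Rintegral => k _; ring.
have := L1_bounded_mul (cosM_measurable (2 * pi * x)) (fun k => norm_cos_le1 _) ei.
congr (mu.-integrable setT (EFin \o _)); apply/funext => k.
by rewrite mulrC (mulrAC (2 * pi)).
Qed.

Lemma pkern_bounded_mul e c B : 0 < e -> measurable_fun setT c ->
  (forall x, `|c x| <= B) -> L1 (fun x => c x * pkern e x) /\
  `|I (fun x => c x * pkern e x)| <= B.
Proof.
move=> e0 mc cB; have [pi1 Ip] := pkern_L1 e0.
have mcp : measurable_fun setT (fun x => c x * pkern e x).
  by apply: measurable_funM => //; exact: L1_measurable.
have le x : `|c x * pkern e x| <= B * pkern e x.
  by rewrite normrM [X in _ * X]ger0_norm ?pkern_ge0 // ler_wpM2r ?pkern_ge0.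
have Bp := L1Zl B pi1.
split; first exact: le_L1 mcp Bp le.
by apply: le_trans (Rint_norm_le mcp Bp le) _; rewrite RintZl // Ip mulr1.
Qed.

(* Away from 0, [pkern e] is bounded by a multiple of [e * pkern 1]. *)
Lemma pkern_approx_identity c B : continuous c -> (forall x, `|c x| <= B) ->
  I (fun x => c x * pkern n.+1%:R^-1 x) @[n --> \oo] --> c 0.
Proof.
move=> cc cB; apply/cvgrPdist_le => d d0.
have B0 : 0 <= B by exact: le_trans (normr_ge0 _) (cB 0).
have mc : measurable_fun setT c by exact: continuous_measurable_fun.
have /cvgrPdist_le/(_ (d / 2)) := cc 0.
move=> /(_ (divr_gt0 d0 _))[//|t /= t0 tc].
pose q : R := (2 * pi * t) ^+ 2.
have q0 : 0 < q by rewrite exprn_gt0 // !mulr_gt0 ?pi_gt0.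
(* For x of modulus at least [t], [pkern e x] is at most (1 + 1 / q) e [pkern 1 x], while
   [c 0 - c x] is at most 2B in modulus. *)
pose C := 2 * B * (1 + q^-1).
have C0 : 0 <= C by rewrite /C !mulr_ge0 ?addr_ge0 ?invr_ge0 ?(ltW q0).
have [p1i Ip1] := pkern_L1 (@ltr01 R).
(* The integrand is dominated by [d / 2 * pkern e x] near 0 and by [C * e * pkern 1 x] elsewhere;
   both kernels have mass 1. *)
have key e : 0 < e -> `|c 0 - I (fun x => c x * pkern e x)| <= d / 2 + C * e.
  move=> e0; have [pei Ipe] := pkern_L1 e0.
  have [cpi _] := pkern_bounded_mul e0 mc cB.
  have -> : c 0 - I (fun x => c x * pkern e x) = I (fun x => c 0 * pkern e x - c x * pkern e x).
    by rewrite (RintB (L1Zl (c 0) pei) cpi) (RintZl (c 0) pei) Ipe mulr1.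
  have gi : L1 (fun x => d / 2 * pkern e x + C * e * pkern 1 x).
    by apply: L1D; exact: L1Zl.
  have -> : d / 2 + C * e = I (fun x => d / 2 * pkern e x + C * e * pkern 1 x).
    by rewrite (RintD (L1Zl (d / 2) pei) (L1Zl (C * e) p1i)) (RintZl (d / 2) pei) (RintZl (C * e) p1i) Ipe Ip1 !mulr1.
  apply: Rint_norm_le => // [|x].
    apply: measurable_funB; apply: measurable_funM => //; exact: L1_measurable.
  rewrite -mulrBl normrM [X in _ * X]ger0_norm ?pkern_ge0 //.
  have p0 := pkern_ge0 x e0; have p10 := pkern_ge0 x (@ltr01 R).
  have [xt|tx] := ltP `|x| t.
    apply: (@le_trans _ _ (d / 2 * pkern e x)); last first.
      by rewrite lerDl; apply: mulr_ge0 => //; apply: mulr_ge0 => //; exact: ltW.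
    by apply: ler_wpM2r => //; apply: tc => /=; rewrite sub0r normrN.
  apply: (@le_trans _ _ (C * e * pkern 1 x)); last first.
    by rewrite lerDr mulr_ge0 // divr_ge0 // ltW.
  have c2B : `|c 0 - c x| <= 2 * B.
    by apply: le_trans (ler_normB _ _) _; have := cB 0; have := cB x; lra.
  apply: (@le_trans _ _ (2 * B * pkern e x)); first exact: ler_wpM2r.
  rewrite /C -!mulrA ler_wpM2l // ler_wpM2l //.
  rewrite /pkern; set Q := (2 * pi * x) ^+ 2.
  have qQ : q <= Q.
    rewrite /q /Q -[leRHS]real_normK ?num_real // normrM lerXn2r ?nnegrE //.
    - by rewrite !mulr_ge0 ?pi_ge0 // ltW.
    - by rewrite ger0_norm ?mulr_ge0 ?pi_ge0 // ler_wpM2l // mulr_ge0 ?pi_ge0.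
  have Q0 : 0 < Q by exact: lt_le_trans qQ.
  rewrite expr1n mulr1.
  apply: (@le_trans _ _ (2 * e / Q)).
    rewrite ler_wpM2l ?mulr_ge0 ?(ltW e0) // lef_pV2 ?posrE ?lerDr ?sqr_ge0 //.
    by rewrite ltr_wpDl ?sqr_ge0.
  have -> : (1 + q^-1) * (e * (2 / (1 + Q))) = 2 * e * ((1 + q^-1) / (1 + Q)) by ring.
  rewrite ler_wpM2l ?mulr_ge0 ?(ltW e0) // ler_pdivlMr ?addr_gt0 //.
  rewrite mulrDr mulr1 mulVf ?gt_eqF // addrC lerD2l lef_pV2 ?posrE //.
have cv : (d / 2 + C * n.+1%:R^-1) @[n --> \oo] --> d / 2 + C * 0.
  apply: cvgD; first exact: cvg_cst.
  by apply: cvgM; [exact: cvg_cst|exact: cvg_harmonic].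
near=> n; apply: (le_trans (key _ _)); first by rewrite invr_gt0.
near: n.
rewrite mulr0 addr0 in cv.
move/cvgrPdist_le : cv => /(_ (d / 2)) /(_ (divr_gt0 d0 _)) [//|N _ HN].
exists N => // n /= Nn; have := HN n Nn; rewrite ler_norml => /andP[+ _].
by rewrite /=; move: (C / _) => z H; lra.
Unshelve. all: by end_near.
Qed.

End Transforms.

(** * Convolutions of compactly supported functions and their transforms *)

Section Convolution.
Variable R : realType.
Local Notation mu := (@lebesgue_measure R).
Local Notation L1 f := (mu.-integrable setT (EFin \o (f : R -> R))).
Local Notation I f := (Rintegral mu setT (f : R -> R)).
Implicit Types (u w c T : R -> R) (k x y e M K : R).

Lemma Rint_dominated (f_ : nat -> R -> R) (f g : R -> R) :
  (forall n, measurable_fun setT (f_ n)) ->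
  (forall x, f_ n x @[n --> \oo] --> f x) -> L1 g ->
  (forall n x, `|f_ n x| <= g x) -> L1 f -> I (f_ n) @[n --> \oo] --> I f.
Proof.
move=> mf ff gi fg fi; rewrite /Rintegral.
apply: (fine_cvg (f := fun n => (\int[mu]_x (f_ n x)%:E)%E)).
rewrite fineK; last exact: integrable_fin_num.
apply: (@dominated_cvg _ _ _ mu setT measurableT _ _ (EFin \o g)) => //.
- by move=> n; apply/measurable_EFinP; exact: mf.
- by move=> x _; apply: cvg_EFin; [apply: nearW|exact: ff].
- by move=> n x _; rewrite lee_fin; exact: fg.
Qed.

(** By monotone convergence the integral of [f] is the limit of integrals bounded by [B]. *)
Lemma L1_monotone (f_ : nat -> R -> R) (f : R -> R) (B : R) :
  (forall n, L1 (f_ n)) -> (forall n x, 0 <= f_ n x) ->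
  (forall x, {homo (fun n => f_ n x) : n m / (n <= m)%N >-> n <= m}) ->
  (forall x, f_ n x @[n --> \oo] --> f x) -> measurable_fun setT f ->
  (forall n, I (f_ n) <= B) -> L1 f.
Proof.
move=> fi f0 ndf ff mf fB.
have fge0 x : 0 <= f x.
  have /cvg_lim <- // := ff x; apply: limr_ge; first exact: cvgP (ff x).
  by apply: nearW.
have fE : (\int[mu]_x (f x)%:E)%E = (\int[mu]_x limn (fun n => (f_ n x)%:E))%E.
  apply: eq_integral => x _; apply/esym/cvg_lim => //.
  by apply: cvg_EFin; [apply: nearW|exact: ff].
apply/integrableP; split; first exact/measurable_EFinP.
under eq_integral do rewrite /= ger0_norm //.
rewrite fE; apply: (@le_lt_trans _ _ B%:E); last exact: ltry.
have H := @cvg_monotone_convergence _ _ _ mu setT measurableT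
  (fun n x => (f_ n x)%:E) (fun n => measurable_int _ (fi n))
  (fun n x _ => f0 n x) (fun x _ n m nm => ndf x n m nm).
rewrite -(cvg_lim _ H) //; apply: lime_le; first by apply/cvg_ex; eexists; exact: H.
by apply: nearW => n; have /= -> := Rint_fin (fi n); rewrite lee_fin.
Qed.

(** Membership in [Cc] with explicit constants, from which the dominating functions are built. *)
Definition bump u M K :=
  [/\ continuous u, forall x, `|u x| <= M & forall x, K < `|x| -> u x = 0].

Lemma bump_measurable u M K : bump u M K -> measurable_fun setT u.
Proof. by case=> cu _ _; exact: continuous_measurable_fun. Qed.

Lemma box_L1 M K : L1 (fun x => M * \1_(`[- K, K]) x).
Proof. exact: L1Zl (@integrable_indic_itv R (- K) K true false). Qed.

Lemma bump_L1 u M K : bump u M K -> L1 u.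
Proof.
move=> bu; have [_ uM uK] := bu.
apply: le_L1 (bump_measurable bu) (box_L1 M K) _ => x.
have M0 : 0 <= M := le_trans (normr_ge0 _) (uM 0).
have [Kx|xK] := ltP K `|x|.
  by rewrite uK // normr0 mulr_ge0 // indicE.
rewrite indicE mem_set ?mulr1 //.
by rewrite /= in_itv /= -ler_norml.
Qed.

Lemma bump_reflect u M K : bump u M K -> bump (fun x => u (- x)) M K.
Proof.
case=> cu uM uK; split=> // [x|x Kx]; last by rewrite uK // normrN.
by apply: continuous_comp; [exact: oppr_continuous|exact: cu].
Qed.

Lemma bump_subl_measurable w N L x : bump w N L ->
  measurable_fun setT (fun y => w (x - y)).
Proof.
case=> cw _ _; apply: continuous_measurable_fun => y.
apply: (cvg_comp (fun y => x - y) w); last exact: cw.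
by apply: cvgB; [exact: cvg_cst|exact: cvg_id].
Qed.

Section Rconv.
Variables (u w : R -> R) (M N K L : R).
Hypotheses (bu : bump u M K) (bw : bump w N L).

Let ui : L1 u := bump_L1 bu.
Let wi : L1 w := bump_L1 bw.

Lemma rconv_term_L1 x : L1 (fun y => u y * w (x - y)).
Proof.
have [_ wN _] := bw; apply: le_L1 (L1Zl N (integrable_norm ui)) _.
  apply: measurable_funM; first exact: bump_measurable bu.
  exact: bump_subl_measurable bw.
by move=> y; rewrite normrM mulrC ler_wpM2r.
Qed.

Lemma rconv_continuous : continuous (rconv u w).
Proof.
have [cw wN _] := bw.
apply: (@continuous_Rint R _ (fun y => N * `|u y|)).
- move=> x; apply: measurable_funM; first exact: bump_measurable bu.
  exact: bump_subl_measurable bw.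
- move=> y x; apply: cvgM; first exact: cvg_cst.
  apply: (cvg_comp (fun x => x - y) w); last exact: cw.
  by apply: cvgB; [exact: cvg_id|exact: cvg_cst].
- exact: L1Zl (integrable_norm ui).
- by move=> x y; rewrite normrM mulrC ler_wpM2r.
Qed.

Lemma rconv_bounded x : `|rconv u w x| <= N * I (fun y => `|u y|).
Proof.
have [cw wN _] := bw.
have nui := integrable_norm ui.
rewrite -(RintZl N nui); apply: Rint_norm_le; last 1 first.
- by move=> y; rewrite normrM mulrC ler_wpM2r.
- apply: measurable_funM; first exact: bump_measurable bu.
  exact: bump_subl_measurable bw.
- exact: L1Zl.
Qed.

(** Fubini and the translation z = x - y. An arbitrary bounded continuous [T] covers the cosine, the
    sine and the constant 1 at once. *)
Lemma rconv_transform T : continuous T -> (forall x, `|T x| <= 1) ->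
  L1 (fun x => T x * rconv u w x) /\
  I (fun x => T x * rconv u w x) = I (fun y => u y * I (fun z => T (z + y) * w z)).
Proof.
move=> cT T1; have [cu uM uK] := bu; have [cw wN wL] := bw.
pose F x y := T x * (u y * w (x - y)).
have N0 : 0 <= N := le_trans (normr_ge0 _) (wN 0).
have mT : measurable_fun setT T by exact: continuous_measurable_fun.
have mF : measurable_fun setT (fun z : measurableTypeR R * measurableTypeR R => F z.1 z.2).
  apply: measurable_funM; first by apply: (measurableT_comp (f := T)).
  apply: measurable_funM.
    by apply: (measurableT_comp (f := u)) => //; exact: bump_measurable bu.
  apply: (measurableT_comp (f := w)); first exact: bump_measurable bw.
  exact: measurable_funB.
(* A nonzero term needs [y] within [K] and [x - y] within [L], hence [x] within [K + L]. *)
have bF x y : `|F x y| <= N * \1_(`[- (K + L), K + L]) x * `|u y|.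
  rewrite /F normrM; apply: (@le_trans _ _ `|u y * w (x - y)|).
    by rewrite ler_piMl.
  rewrite normrM mulrC.
  have [Ky|yK] := ltP K `|y|; first by rewrite uK // normr0 !mulr0.
  apply: ler_wpM2r => //.
  have [Lxy|xyL] := ltP L `|x - y|.
    by rewrite wL // normr0 mulr_ge0 // indicE.
  rewrite indicE mem_set ?mulr1 //= in_itv /= -ler_norml.
  by rewrite -[x](subrK y) addrC; apply: le_trans (ler_normD _ _) (lerD _ _).
have wsh y : L1 (fun x => T x * w (x - y)) /\
    I (fun x => T x * w (x - y)) = I (fun z => T (z + y) * w z).
  have H : L1 (fun z => T (z + y) * w z).
    apply: L1_bounded_mul wi => //; apply: continuous_measurable_fun => z.
    apply: (cvg_comp (fun z => z + y) T); last exact: cT.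
    by apply: cvgD; [exact: cvg_id|exact: cvg_cst].
  have [] := Rint_shift (- y) H.
  have -> : (fun x => T (x - y + y) * w (x - y)) = (fun x => T x * w (x - y)).
    by apply/funext => x; rewrite subrK.
  by [].
have [Fi FE] := Rint_fubini mF (box_L1 N (K + L)) (integrable_norm ui) bF.
have E1 : (fun x => I (F x)) = (fun x => T x * rconv u w x).
  by apply/funext => x; rewrite /F /rconv RintZl //; exact: rconv_term_L1.
rewrite -E1; split; first exact: Fi.
rewrite FE; apply: eq_Rintegral => y _.
have [w1 <-] := wsh y; rewrite -RintZl //; apply: eq_Rintegral => x _.
by rewrite /F mulrCA.
Qed.

Lemma rconv_L1 : L1 (rconv u w).
Proof.
have [|x|] := @rconv_transform (fun=> 1).
- by move=> x; exact: cvg_cst.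
- by rewrite normr1.
- have -> : (fun x => 1 * rconv u w x) = rconv u w by apply/funext => x; rewrite mul1r.
  by [].
Qed.

(** The real part of the convolution theorem, from the addition formula for the cosine. *)
Lemma ct_rconv k : ct (rconv u w) k = ct u k * ct w k - st u k * st w k.
Proof.
have [|x|_ H] := @rconv_transform (fun x => cos (2 * pi * k * x)).
- by apply: continuous_comp_mull; exact: continuous_cos.
- exact: norm_cos_le1.
have cw := cosL1 (2 * pi * k) wi; have sw := sinL1 (2 * pi * k) wi.
have cu := cosL1 (2 * pi * k) ui; have su := sinL1 (2 * pi * k) ui.
rewrite [LHS]/ct H; transitivity (I (fun y => ct w k * (cos (2 * pi * k * y) * u y) -
    st w k * (sin (2 * pi * k * y) * u y))); last first.
  by rewrite (RintB (L1Zl (ct w k) cu) (L1Zl (st w k) su)) (RintZl _ cu) (RintZl _ su) -/(ct u k) -/(st u k); ring.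
apply: eq_Rintegral => y _.
have -> : I (fun z => cos (2 * pi * k * (z + y)) * w z) =
    cos (2 * pi * k * y) * ct w k - sin (2 * pi * k * y) * st w k; last by ring.
rewrite -(RintZl _ cw) -(RintZl _ sw) -(RintB (L1Zl _ cw) (L1Zl _ sw)).
by apply: eq_Rintegral => z _; rewrite mulrDr cosD; ring.
Qed.

Lemma st_rconv k : st (rconv u w) k = ct u k * st w k + st u k * ct w k.
Proof.
have [|x|_ H] := @rconv_transform (fun x => sin (2 * pi * k * x)).
- by apply: continuous_comp_mull; exact: continuous_sin.
- exact: norm_sin_le1.
have cw := cosL1 (2 * pi * k) wi; have sw := sinL1 (2 * pi * k) wi.
have cu := cosL1 (2 * pi * k) ui; have su := sinL1 (2 * pi * k) ui.
rewrite [LHS]/st H; transitivity (I (fun y => st w k * (cos (2 * pi * k * y) * u y) +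
    ct w k * (sin (2 * pi * k * y) * u y))); last first.
  by rewrite (RintD (L1Zl (st w k) cu) (L1Zl (ct w k) su)) (RintZl _ cu) (RintZl _ su) -/(ct u k) -/(st u k); ring.
apply: eq_Rintegral => y _.
have -> : I (fun z => sin (2 * pi * k * (z + y)) * w z) =
    cos (2 * pi * k * y) * st w k + sin (2 * pi * k * y) * ct w k; last by ring.
rewrite -(RintZl _ cw) -(RintZl _ sw) -(RintD (L1Zl _ sw) (L1Zl _ cw)).
by apply: eq_Rintegral => z _; rewrite mulrDr sinD; ring.
Qed.
End Rconv.
End Convolution.

(** * Fourier inversion at the origin for convolutions *)

Section FourierInversion.
Variable R : realType.
Local Notation mu := (@lebesgue_measure R).
Local Notation L1 f := (mu.-integrable setT (EFin \o (f : R -> R))).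
Local Notation I f := (Rintegral mu setT (f : R -> R)).
Implicit Types (u w c : R -> R) (k x e M K : R).

Lemma ekern_cvg1 k : ekern n.+1%:R^-1 k @[n --> \oo] --> (1 : R).
Proof.
have h : - (n.+1%:R^-1 * `|k|) @[n --> \oo] --> (0 : R).
  rewrite -oppr0 -(mul0r `|k|); apply: cvgN; apply: cvgM; last exact: cvg_cst.
  exact: cvg_harmonic.
rewrite -[X in _ --> X]expR0.
exact: (cvg_comp _ _ h (@continuous_expR R 0)).
Qed.

(** This squared modulus is the cosine transform of [c], the convolution of [u] with its reflection.
    Its Abel means increase to it, and their integrals equal those of [c] against the Poisson
    kernel, hence are at most a bound of [c]. *)
Lemma bump_sq_L1 u M K : bump u M K -> L1 (fun k => ct u k ^+ 2 + st u k ^+ 2).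
Proof.
move=> bu; have ui := bump_L1 bu; have bv := bump_reflect bu.
pose v x := u (- x); pose c := rconv u v.
have ci : L1 c := rconv_L1 bu bv.
have cE k : ct c k = ct u k ^+ 2 + st u k ^+ 2.
  by rewrite /c (ct_rconv bu bv) ct_reflect // st_reflect // mulrN opprK -!expr2.
have <- : ct c = (fun k => ct u k ^+ 2 + st u k ^+ 2) by apply/funext.
have ct0 k : 0 <= ct c k by rewrite cE addr_ge0 ?sqr_ge0.
have e0 n : 0 < n.+1%:R^-1 :> R by rewrite invr_gt0.
apply: (L1_monotone (f_ := fun n k => ekern n.+1%:R^-1 k * ct c k)
   (B := M * I (fun y => `|u y|))).
- by move=> n; have [] := Rint_ekern_ct (e0 n) ci.
- by move=> n k; rewrite mulr_ge0 ?ekern_ge0.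
- move=> k m n mn; apply: ler_wpM2r => //.
  rewrite /ekern ler_expR lerN2 ler_wpM2r // lef_pV2 ?posrE // ler_nat ltnS //.
- move=> k; rewrite -[X in _ --> X]mul1r; apply: cvgM; last exact: cvg_cst.
  exact: ekern_cvg1.
- by apply: continuous_measurable_fun; exact: ct_continuous.
- move=> n; have [_ ->] := Rint_ekern_ct (e0 n) ci.
  have [_] := pkern_bounded_mul (e0 n) (L1_measurable ci) (rconv_bounded bu bv).
  exact: le_trans (ler_norm _).
Qed.

(** Fourier inversion at the point 0 with all integrability it needs; only the value [c 0] is seen
    by the Dirac mass. *)
Definition invertible c :=
  [/\ L1 c, L1 (ct c), L1 (st c), I (ct c) = c 0 & I (st c) = 0].

(** Each product in the transform of the convolution is bounded by a sum of squares, so the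
    transform is integrable. Its Abel means then converge to the integral by dominated convergence,
    and to [c 0] by the approximate identity. *)
Lemma invertible_rconv u w M N K L : bump u M K -> bump w N L -> invertible (rconv u w).
Proof.
move=> bu bw; have hu := bump_sq_L1 bu; have hw := bump_sq_L1 bw.
set c := rconv u w.
have ci : L1 c := rconv_L1 bu bw.
have bound (a b a' b' : R) : `|a * b| + `|a' * b'| <=
    (a ^+ 2 + a' ^+ 2) + (b ^+ 2 + b' ^+ 2).
  have h (x y : R) : `|x * y| <= x ^+ 2 + y ^+ 2.
    rewrite normrM -(real_normK (num_real x)) -(real_normK (num_real y)).
    have := sqr_ge0 (`|x| - `|y|); have := normr_ge0 x; have := normr_ge0 y.
    by move: `|x| `|y| => p q; nra.
  by have := h a b; have := h a' b'; lra.
have g1 := L1D hu hw.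
have cti : L1 (ct c).
  apply: le_L1 g1 _ => [|k].
    by apply: continuous_measurable_fun; exact: ct_continuous.
  rewrite /c (ct_rconv bu bw); apply: le_trans (ler_normB _ _) _; exact: bound.
have sti : L1 (st c).
  apply: le_L1 g1 _ => [|k].
    by apply: continuous_measurable_fun; exact: st_continuous.
  rewrite /c (st_rconv bu bw); apply: le_trans (ler_normD _ _) _.
  by apply: le_trans (bound _ _ _ _) _; lra.
split=> //; last exact: Rint_st.
have e0 n : 0 < n.+1%:R^-1 :> R by rewrite invr_gt0.
have l1 : I (fun k => ekern n.+1%:R^-1 k * ct c k) @[n --> \oo] --> I (ct c).
  apply: (Rint_dominated (g := fun k => `|ct c k|)) => //.
  - by move=> n; apply: L1_measurable; have [] := Rint_ekern_ct (e0 n) ci.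
  - move=> k; rewrite -[X in _ --> X]mul1r; apply: cvgM; last exact: cvg_cst.
    exact: ekern_cvg1.
  - exact: integrable_norm.
  - move=> n k; rewrite normrM ler_piMl // ger0_norm ?ekern_ge0 //.
    by rewrite /ekern -[leRHS]expR0 ler_expR oppr_le0 mulr_ge0 // ltW.
have l2 := pkern_approx_identity (rconv_continuous bu bw) (rconv_bounded bu bw).
rewrite -/c in l2.
(* Both values are limits of one sequence, by [Rint_ekern_ct]. *)
rewrite -(cvg_lim (@Rhausdorff R) l1) -(cvg_lim (@Rhausdorff R) l2).
by congr (lim (_ @ \oo)); apply/funext => n; have [_ ->] := Rint_ekern_ct (e0 n) ci.
Qed.

Lemma ctD c d k : L1 c -> L1 d -> ct (fun x => c x + d x) k = ct c k + ct d k.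
Proof.
move=> ci di; rewrite -(RintD (cosL1 _ ci) (cosL1 _ di)).
by apply: eq_Rintegral => x _; rewrite mulrDr.
Qed.

Lemma stD c d k : L1 c -> L1 d -> st (fun x => c x + d x) k = st c k + st d k.
Proof.
move=> ci di; rewrite -(RintD (sinL1 _ ci) (sinL1 _ di)).
by apply: eq_Rintegral => x _; rewrite mulrDr.
Qed.

Lemma invertibleD c d : invertible c -> invertible d -> invertible (fun x => c x + d x).
Proof.
move=> [ci cci sci c1 c2] [di cdi sdi d1 d2].
have E1 : ct (fun x => c x + d x) = (fun k => ct c k + ct d k).
  by apply/funext => k; exact: ctD.
have E2 : st (fun x => c x + d x) = (fun k => st c k + st d k).
  by apply/funext => k; exact: stD.
split; rewrite ?E1 ?E2; [exact: L1D|exact: L1D|exact: L1D| |].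
- by rewrite RintD // c1 d1.
- by rewrite RintD // c2 d2 addr0.
Qed.

Lemma invertibleN c : invertible c -> invertible (fun x => - c x).
Proof.
move=> [ci cci sci c1 c2].
have E1 : ct (fun x => - c x) = (fun k => -1 * ct c k).
  apply/funext => k; rewrite -(RintZl _ (cosL1 _ ci)).
  by apply: eq_Rintegral => x _; rewrite mulrN mulN1r.
have E2 : st (fun x => - c x) = (fun k => -1 * st c k).
  apply/funext => k; rewrite -(RintZl _ (sinL1 _ ci)).
  by apply: eq_Rintegral => x _; rewrite mulrN mulN1r.
split; rewrite ?E1 ?E2; [exact: L1N|exact: L1Zl|exact: L1Zl| |].
- by rewrite RintZl // c1 mulN1r.
- by rewrite RintZl // c2 mulr0.
Qed.

Lemma invertible0 : invertible (fun=> 0).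
Proof.
have E1 : ct (fun=> 0) = (fun _ : R => 0 : R).
  apply/funext => k; rewrite /ct /Rintegral.
  by under eq_integral do rewrite mulr0; rewrite integral0.
have E2 : st (fun=> 0) = (fun _ : R => 0 : R).
  apply/funext => k; rewrite /st /Rintegral.
  by under eq_integral do rewrite mulr0; rewrite integral0.
have z : L1 (fun=> 0) by exact: integrable0.
split; rewrite ?E1 ?E2 //; by rewrite /Rintegral integral0.
Qed.

Lemma invertible_sum m (c : 'I_m -> R -> R) : (forall i, invertible (c i)) ->
  invertible (fun x => \sum_(i < m) c i x).
Proof.
elim: m c => [|m IHm] c Hc.
  have -> : (fun x => \sum_(i < 0) c i x) = (fun=> 0).
    by apply/funext => x; rewrite big_ord0.
  exact: invertible0.
have -> : (fun x => \sum_(i < m.+1) c i x) =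
    (fun x => \sum_(i < m) c (widen_ord (leqnSn m) i) x + c ord_max x).
  by apply/funext => x; rewrite big_ord_recr.
by apply: invertibleD => //; apply: IHm.
Qed.

End FourierInversion.

(** * The diffraction measure *)

Section Fourier.
Variable R : realType.
Local Notation mu := (@lebesgue_measure R).
Local Notation L1 f := (mu.-integrable setT (EFin \o (f : R -> R))).
Local Notation I f := (Rintegral mu setT (f : R -> R)).
Local Notation re := (@complex.Re R).
Local Notation im := (@complex.Im R).

Lemma Cc_bump (u : R -> R) : Cc u -> exists M K, bump u M K.
Proof.
move=> cu; have [M [K [_ _ uM uK]]] := Cc_bounded cu.
by exists M, K; split=> //; case: cu.
Qed.

Lemma invertible_rconv_Cc (u w : R -> R) : Cc u -> Cc w -> invertible (rconv u w).
Proof.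
move=> /Cc_bump[M [K bu]] /Cc_bump[N [L bw]]; exact: invertible_rconv bu bw.
Qed.

Lemma rconv_term_L1_Cc (u w : R -> R) x : Cc u -> Cc w -> L1 (fun y => u y * w (x - y)).
Proof. by move=> /Cc_bump[M [K bu]] /Cc_bump[N [L bw]]; exact: rconv_term_L1 bu bw x. Qed.

Lemma Re_sum m (F : 'I_m -> R[i]) : re (\sum_(i < m) F i) = \sum_(i < m) re (F i).
Proof. exact: raddf_sum. Qed.

Lemma Im_sum m (F : 'I_m -> R[i]) : im (\sum_(i < m) F i) = \sum_(i < m) im (F i).
Proof. exact: raddf_sum. Qed.

Lemma Re_mul (a b : R[i]) : re (a * b) = re a * re b - im a * im b.
Proof. by case: a b => [a1 a2] [b1 b2]. Qed.

Lemma Im_mul (a b : R[i]) : im (a * b) = re a * im b + im a * re b.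
Proof. by case: a b => [a1 a2] [b1 b2]. Qed.

Lemma Re_conv (f g : R -> R[i]) x : cCc f -> cCc g ->
  re (Defs.conv f g x) = rconv (re \o f) (re \o g) x - rconv (im \o f) (im \o g) x.
Proof.
move=> [f1 f2] [g1 g2]; rewrite /Defs.conv /cint /=.
rewrite /rconv -(RintB (rconv_term_L1_Cc x f1 g1) (rconv_term_L1_Cc x f2 g2)).
by apply: eq_Rintegral => y _; rewrite Re_mul.
Qed.

Lemma Im_conv (f g : R -> R[i]) x : cCc f -> cCc g ->
  im (Defs.conv f g x) = rconv (re \o f) (im \o g) x + rconv (im \o f) (re \o g) x.
Proof.
move=> [f1 f2] [g1 g2]; rewrite /Defs.conv /cint /=.
rewrite /rconv -(RintD (rconv_term_L1_Cc x f1 g2) (rconv_term_L1_Cc x f2 g1)).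
by apply: eq_Rintegral => y _; rewrite Im_mul.
Qed.

(** The real and imaginary parts of a complex convolution are combinations of real convolutions of
    functions in [Cc], and inversion is stable under sums and negation. *)
Lemma K2_invertible (g : R -> R[i]) : K2 g -> invertible (re \o g) /\ invertible (im \o g).
Proof.
move=> [m [f1 [f2 [Hf ->]]]]; split.
  have -> : re \o (fun x => \sum_(i < m) Defs.conv (f1 i) (f2 i) x) =
    (fun x => \sum_(i < m) (rconv (re \o f1 i) (re \o f2 i) x +
                            - rconv (im \o f1 i) (im \o f2 i) x)).
    apply/funext => x; rewrite /= Re_sum; apply: eq_bigr => i _.
    by have [h1 h2] := Hf i; rewrite Re_conv.
  apply: invertible_sum => i; have [[h1 h2] [h3 h4]] := Hf i.
  by apply: invertibleD; [|apply: invertibleN]; exact: invertible_rconv_Cc.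
have -> : im \o (fun x => \sum_(i < m) Defs.conv (f1 i) (f2 i) x) =
  (fun x => \sum_(i < m) (rconv (re \o f1 i) (im \o f2 i) x +
                          rconv (im \o f1 i) (re \o f2 i) x)).
  apply/funext => x; rewrite /= Im_sum; apply: eq_bigr => i _.
  by have [h1 h2] := Hf i; rewrite Im_conv.
apply: invertible_sum => i; have [[h1 h2] [h3 h4]] := Hf i.
by apply: invertibleD; exact: invertible_rconv_Cc.
Qed.

Lemma Re_check (g : R -> R[i]) k : L1 (re \o g) -> L1 (im \o g) ->
  re (check g k) = ct (re \o g) k - st (im \o g) k.
Proof.
move=> g1 g2; rewrite /check /cint /=.
rewrite -(RintB (cosL1 _ g1) (sinL1 _ g2)).
by apply: eq_Rintegral => x _; rewrite Re_mul.
Qed.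

Lemma Im_check (g : R -> R[i]) k : L1 (re \o g) -> L1 (im \o g) ->
  im (check g k) = ct (im \o g) k + st (re \o g) k.
Proof.
move=> g1 g2; rewrite /check /cint /=.
rewrite -(RintD (cosL1 _ g2) (sinL1 _ g1)).
by apply: eq_Rintegral => x _; rewrite Im_mul.
Qed.

(** In the real and imaginary parts of [check g] the sine transforms integrate to 0 and the cosine
    transforms to the parts of [g 0], which is the integral of [g] against the Dirac mass. *)
Theorem dirac0_fourier_transform :
  is_fourier_transform (@dirac _ (measurableTypeR R) 0%R R) (@lebesgue_measure R).
Proof.
move=> g /K2_invertible[[a1 a2 a3 a4 a5] [b1 b2 b3 b4 b5]].
have reE : (fun k => re (check g k)) = (fun k => ct (re \o g) k - st (im \o g) k).
  by apply/funext => k; exact: Re_check.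
have imE : (fun k => im (check g k)) = (fun k => ct (im \o g) k + st (re \o g) k).
  by apply/funext => k; exact: Im_check.
split.
  split.
    rewrite -[X in integrable _ _ X]/(EFin \o (fun k => re (check g k))) reE.
    by apply: L1D => //; exact: L1N.
  rewrite -[X in integrable _ _ X]/(EFin \o (fun k => im (check g k))) imE.
  by apply: L1D.
rewrite /cint reE imE !Rintegral_dirac0; [|exact: L1_measurable b1|exact: L1_measurable a1].
by rewrite (RintB a2 b3) (RintD b2 a3) a4 b5 b4 a5 subr0 addr0.
Qed.

End Fourier.

Theorem theorem5p7 (R : realType) :
  counting_autocorrelation_is (@primes_pm R) (@dirac _ (measurableTypeR R) 0%R R) /\
  is_fourier_transform (@dirac _ (measurableTypeR R) 0%R R) (@lebesgue_measure R).
Proof. by split; [exact: primes_pm_autocorrelation|exact: dirac0_fourier_transform]. Qed.
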